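(* Let $d\in\{1,2,3\}$, $T>0$, $\beta=1_{\{d=2\}}$, and let $(u(t,x),\ (t,x)\in[0,T]\times\mathbb{T}^d)$ be the Gaussian process $$u(t,x)=\int_0^t\int_{\mathbb{T}^d}G(t-r;x,z)\,W(dr,dz).$$ 1. There exist positive constants $c_5(d)$ and $C(d)$ such that for any $(t,x),(s,y)\in[0,T]\times\mathbb{T}^d$, $$\Vert u(t,x)-u(s,y)\Vert_{L^2(\Omega)}^2\le c_5(d)\left(|t-s|^{1-d/4}+\left(\log\frac{C(d)}{|x-y|}\right)^{\beta}|x-y|^{2\wedge(4-d)}\right).$$ 2. Fix $t_0\in(0,T]$ and let $J=J_1\times\cdots\times J_d\subsetneq\mathbb{T}^d$, where $J_j=[c_{0,j},2\pi-c_{0,j}]$ with fixed real numbers $0<c_{0,j}<2\pi$, $j=1,\dots,d$. There exist positive constants $c_6(d,t_0,T)$ and $c(d)$ such that for any $(t,x),(s,y)\in[t_0,T]\times J$, $$\Vert u(t,x)-u(s,y)\Vert_{L^2(\Omega)}^2\ge c_6(d,t_0,T)\left(|t-s|^{1-d/4}+\left(\log\frac{c(d)}{|x-y|}\right)^{\beta}|x-y|^{2\wedge(4-d)}\right).$$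
   Context: $\mathbb{N}=\{0,1,2,\dots\}$. $\mathbb{T}^d=(\mathbb{R}/2\pi\mathbb{Z})^d$ is the $d$-dimensional torus with Lebesgue measure. For $x,y\in\mathbb{T}^d$, $|x-y|$ is the Euclidean norm of the representative of $x-y$ in the periodic cube $[-\pi,\pi]^d$ (distance on the torus). For $k\in\mathbb{N}^d$, $\lambda_k=\sum_{j=1}^d k_j^4$ and $n(k)$ is the number of null components of $k$. For $t>0$ and $x,y\in\mathbb{T}^d$, $$G(t;x,y)=\sum_{k\in\mathbb{N}^d}\frac{e^{-\lambda_k t}}{2^{n(k)}\pi^d}\prod_{j=1}^d\cos(k_j(x_j-y_j))$$ (called in the paper the Green's function of the biharmonic heat operator $\frac{\partial}{\partial t}+(-\Delta)^2$ on the torus), and $G(t;x,y)=0$ for $t<0$. $W$ is a space-time (Gaussian) white noise on $[0,T]\times\mathbb{T}^d$ defined on a probability space $\Omega$, and the stochastic integral is a Wiener integral. Conventions: $a\wedge b=\min(a,b)$. In any expression $\log(C/z)$ the constant $C$ is taken large enough that $\log(C/z)\ge1$ for all values of $z$ considered. The factor $(\log(C/z))^\beta$ equals $1$ when $\beta=0$, and $(\log(C/z))^\beta z^{2\wedge(4-d)}$ is taken to be $0$ at $z=0$. Arguments of constants indicate the parameters they depend on.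
   Formalization: In part 1 the constant c_5 may depend on T as well as d: the k=0 term of G gives ‖u(T,x)-u(0,x)‖² ≥ (2π)^{-d}T, which exceeds c_5 T^{1-d/4} for large T, so no c_5 depending on d alone works for all T. *)

(* Defs.v *)
From HB Require Import structures.
From mathcomp Require Export all_boot all_order all_algebra.
From mathcomp Require Export all_classical all_reals all_analysis.
Export Order.TTheory GRing.Theory Num.Theory.
Export numFieldNormedType.Exports.
Export HBSimple.

Set Implicit Arguments.
Unset Strict Implicit.
Unset Printing Implicit Defensive.

Local Open Scope classical_set_scope.
Local Open Scope ring_scope.

Section torus.
Context {R : realType}.

(* The torus (R / 2 pi Z)^d is represented by its fundamental domain
   [0, 2 pi[^d. *)
Definition torus (d : nat) : set (d.-tuple R) :=
  [set x | forall j, 0 <= tnth x j < 2 * pi].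

(* The representative of a modulo 2 pi in [-pi, pi[. *)
Definition centered_rep (a : R) : R :=
  a - 2 * pi * (Num.floor ((a + pi) / (2 * pi)))%:~R.

Definition torus_dist (d : nat) (x y : d.-tuple R) : R :=
  Num.sqrt (\sum_(j < d) centered_rep (tnth x j - tnth y j) ^+ 2).

Definition lambda (d : nat) (k : 'I_d -> nat) : R :=
  \sum_(j < d) (k j)%:R ^+ 4.

Definition null_components (d : nat) (k : 'I_d -> nat) : nat :=
  #|[pred j : 'I_d | k j == 0%N]|.

Definition green_term (d : nat) (t : R) (x y : d.-tuple R)
    (k : 'I_d -> nat) : R :=
  expR (- lambda k * t) / (2 ^+ null_components k * pi ^+ d) *
  \prod_(j < d) cos ((k j)%:R * (tnth x j - tnth y j)).

(* The series over k in N^d converges absolutely for t > 0; its sum is taken as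
   the limit of the partial sums over the cubes {0, ..., N - 1}^d.  The value at
   t = 0, where the series diverges, is irrelevant and set to 0. *)
Definition green (d : nat) (t : R) (x y : d.-tuple R) : R :=
  if 0 < t then
    limn (fun N : nat => \sum_(k : {ffun 'I_d -> 'I_N})
      green_term t x y (fun j => k j : nat))
  else 0.

End torus.

Section torus_measure.
Context {R : realType}.

Definition lebesgue_on (a b : R) : set R -> \bar R :=
  fun A => lebesgue_measure (A `&` `[a, b]).

Section lebesgue_on_measure.
Variables a b : R.

Let lebesgue_on0 : lebesgue_on a b set0 = 0%E.
Proof. by rewrite /lebesgue_on set0I measure0. Qed.

Let lebesgue_on_ge0 A : (0 <= lebesgue_on a b A)%E.
Proof. exact: measure_ge0. Qed.

Let lebesgue_on_sigma_additive : semi_sigma_additive (lebesgue_on a b).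
Proof.
exact: (@measure_semi_sigma_additive _ _ _
  (mrestr (@lebesgue_measure R) (measurable_itv `[a, b]))).
Qed.

HB.instance Definition _ := isMeasure.Build _ _ _ (lebesgue_on a b)
  lebesgue_on0 lebesgue_on_ge0 lebesgue_on_sigma_additive.

Let lebesgue_on_fin : fin_num_fun (lebesgue_on a b).
Proof.
move=> U mU; rewrite ge0_fin_numE ?measure_ge0//.
apply: (@le_lt_trans _ _ (lebesgue_measure `[a, b])).
  by rewrite /lebesgue_on; apply: le_measure; rewrite ?inE//=; exact: measurableI.
by rewrite lebesgue_measure_itv/=; case: ifP => // _; rewrite -EFinB ltry.
Qed.

HB.instance Definition _ := @Measure_isFinite.Build _ _ _ (lebesgue_on a b)
  lebesgue_on_fin.

End lebesgue_on_measure.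

Definition cons_pair (n : nat) (p : R * n.-tuple R) : n.+1.-tuple R :=
  [tuple of p.1 :: p.2].

Lemma measurable_cons_pair (n : nat) : measurable_fun setT (@cons_pair n).
Proof. exact: measurable_cons. Qed.

HB.instance Definition _ (n : nat) :=
  @isMeasurableFun.Build _ _ _ _ (@cons_pair n) (@measurable_cons_pair n).

Definition cons_measure (n : nat) (m1 : {finite_measure set R -> \bar R})
    (m2 : {finite_measure set (n.-tuple R) -> \bar R}) :
    set (n.+1.-tuple R) -> \bar R :=
  pushforward (m1 \x m2)%E (@cons_pair n).

Section cons_measure_instances.
Variables (n : nat) (m1 : {finite_measure set R -> \bar R}).
Variable m2 : {finite_measure set (n.-tuple R) -> \bar R}.

Let cons_measure0 : cons_measure m1 m2 set0 = 0%E.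
Proof. exact: measure0. Qed.

Let cons_measure_ge0 A : (0 <= cons_measure m1 m2 A)%E.
Proof. exact: measure_ge0. Qed.

Let cons_measure_sigma_additive : semi_sigma_additive (cons_measure m1 m2).
Proof. exact: measure_semi_sigma_additive. Qed.

HB.instance Definition _ := isMeasure.Build _ _ _ (cons_measure m1 m2)
  cons_measure0 cons_measure_ge0 cons_measure_sigma_additive.

Let cons_measure_fin : fin_num_fun (cons_measure m1 m2).
Proof.
move=> U mU; rewrite ge0_fin_numE ?measure_ge0//.
apply: (@le_lt_trans _ _ (cons_measure m1 m2 setT)).
  by apply: le_measure; rewrite ?inE.
rewrite /cons_measure /pushforward preimage_setT -setXTT product_measure1E//.
by rewrite lte_mul_pinfty// ?ge0_fin_numE// ?fin_num_measure// ltey_eq fin_num_measure.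
Qed.

HB.instance Definition _ :=
  @Measure_isFinite.Build _ _ _ (cons_measure m1 m2) cons_measure_fin.
End cons_measure_instances.

(* The closed interval [0, 2 pi] only adds a null set to the fundamental
   domain. *)
Fixpoint torus_measure (d : nat) :
    {finite_measure set (d.-tuple R) -> \bar R} :=
  match d with
  | 0 => \d_ [tuple]
  | n.+1 => cons_measure (lebesgue_on 0 (2 * pi)) (torus_measure n)
  end.

Definition spacetime_measure (T : R) (d : nat) :
    set (R * d.-tuple R) -> \bar R :=
  (lebesgue_on 0 T \x torus_measure d)%E.

Arguments spacetime_measure : clear implicits.

HB.instance Definition _ (T : R) (d : nat) :=
  Measure.on (spacetime_measure T d).

End torus_measure.
Arguments spacetime_measure {R} T d.

Section white_noise.
Context {R : realType} {d d' : measure_display}.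
Context {S : measurableType d} {Omega : measurableType d'}.
Variables (mu : {measure set S -> \bar R}) (P : probability Omega R).

(* normal_prob is not the Dirac mass when its standard deviation is 0. *)
Definition centered_normal (X : Omega -> R) (s : R) : Prop :=
  if s == 0 then {ae P, forall w, X w = 0}
  else forall B : set R, measurable B -> P (X @^-1` B) = normal_prob 0 s B.

Record is_white_noise (W : set S -> {RV P >-> R}) : Prop := IsWhiteNoise {
  white_noise_gaussian : forall (n : nat) (a : 'I_n -> R) (A : 'I_n -> set S),
    (forall i, measurable (A i)) -> (forall i, mu (A i) < +oo)%E ->
    exists s : R, centered_normal (fun w => \sum_(i < n) a i * W (A i) w) s;
  white_noise_covariance : forall A B : set S,
    measurable A -> measurable B -> (mu A < +oo)%E -> (mu B < +oo)%E ->
    ('E_P[fun w => (W A w * W B w)%R] = mu (A `&` B))%E }.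

Variable W : set S -> {RV P >-> R}.

Definition wiener_simple (f : {sfun S >-> R}) : Omega -> R :=
  fun w => \sum_(y \in range f) y * W (f @^-1` [set y]) w.

(* X is (a version of) the integral of f with respect to W: the L^2(Omega)-limit
   of the integrals of simple functions converging to f in L^2(mu). *)
Definition is_wiener_integral (f : S -> R) (X : {RV P >-> R}) : Prop :=
  exists g : nat -> {sfun S >-> R},
    ('N[mu]_(2%:E) [EFin \o (fun z => g n z - f z)%R] @[n --> \oo] --> 0)%E /\
    ('N[P]_(2%:E) [EFin \o (fun w => wiener_simple (g n) w - X w)%R]
       @[n --> \oo] --> 0)%E.

End white_noise.

Section biharmonic.
Context {R : realType} (T : R) (d : nat).
Context {d' : measure_display} {Omega : measurableType d'}.
Variable P : probability Omega R.

Definition is_biharmonic_process (W : set (R * d.-tuple R) -> {RV P >-> R})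
    (u : R -> d.-tuple R -> {RV P >-> R}) : Prop :=
  forall (t : R) (x : d.-tuple R), 0 <= t <= T -> torus x ->
    is_wiener_integral (spacetime_measure T d) W
      (fun rz => if 0 <= rz.1 <= t then green (t - rz.1) x rz.2 else 0) (u t x).

Definition L2_dist_sqr (X Y : {RV P >-> R}) : \bar R :=
  ('N[P]_(2%:E) [EFin \o (fun w => X w - Y w)%R] ^+ 2)%E.

End biharmonic.

Section modulus.
Context {R : realType}.

(* For d in {1, 2, 3} the natural-number subtraction 4 - d is exact and the
   exponent of z is positive, so the second term vanishes at z = 0. *)
Definition modulus (d : nat) (C h z : R) : R :=
  h `^ (1 - d%:R / 4) + ln (C / z) ^+ (d == 2%N) * z ^+ minn 2 (4 - d).

Definition log_ge1 (d : nat) (C : R) : Prop :=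
  forall x y : d.-tuple R, torus x -> torus y -> torus_dist x y != 0 ->
    1 <= ln (C / torus_dist x y).

Definition torus_box (d : nat) (c0 : 'I_d -> R) : set (d.-tuple R) :=
  [set x | forall j, c0 j <= tnth x j <= 2 * pi - c0 j].

End modulus.

(* Main.v *)
(* The stochastic integral is an L^2 isometry, so the left-hand sides are the
   squared L^2 norms of differences of Green kernels.  Expanding the kernels in
   the orthogonal cosine basis turns such a norm into a series over k in N^d
   whose term is, up to the factor 1 / (2^{n(k)} pi^d), with l = lambda_k,
   c = prod_j cos (k_j (x_j - y_j)), h = |t - s|, q = e^{-l h} and
   w = e^{-2 l min(s, t)},
     ((1 - q^2) + (1 - w) (q^2 + 1 - 2 c q)) / (2 l).
   This lies below min(h, 1/l) + (1 - c) / l, and above both h / (1 + 2 l h) and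
   (1 - e^{-2 t_0}) (1 - c) / (2 l).  As lambda_k is comparable to m^4 for
   m = max_j k_j, and about m^{d-1} frequencies have maximum m, everything
   reduces to one-dimensional sums in m: the time part is concentrated on
   m <= h^{-1/4}, the space part on m <= 1 / |x - y|, with the logarithm of the
   case d = 2 coming from the harmonic sum. *)
Require Import Defs.
From mathcomp Require Import all_boot all_order all_algebra.
From mathcomp Require Import all_classical all_reals all_analysis.
From mathcomp Require Import measurable_realfun ring lra.
Import Order.TTheory GRing.Theory Num.Theory.

Set Implicit Arguments.
Unset Strict Implicit.
Unset Printing Implicit Defensive.

Local Open Scope classical_set_scope.
Local Open Scope ring_scope.

(** The kernels are only pointwise limits of sums over cubes of frequencies, so the limit must be
    exchanged with the square integral. Orthogonality turns the square integral over any block of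
    modes into a sum of [mode_dist], so the partial sums are Cauchy once the numerical series is
    bounded: the upper estimate also supplies the convergence.

    The delicate estimate is the lower one in space, since negative cosines may compensate each
    other in the product. It keeps only frequencies whose largest entry sits at the coordinate j
    where |x_j - y_j| is largest, say D, and for which k_j D <= pi/2: the j-th cosine is then
    nonnegative and the other factors cannot undo its deviation from 1. If D > pi/2 nothing remains
    in this family, and the unit frequency at j replaces it.

    At the null frequency l = 0 the mode is a Brownian motion and contributes a multiple of |t - s|.
    Bounding this by |t - s|^(1 - d/4) costs a factor T^(d/4), whence the dependence of [c5] on
    T. *)

(** * Square integrals and the L2 norm *)

Section square_integrals.
Context {R : realType} {d : measure_display} {T : measurableType d}.
Variable mu : {measure set T -> \bar R}.

Lemma Lnorm2E (f : T -> R) :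
  ('N[mu]_(2%:E) [EFin \o f] = (\int[mu]_x (f x ^+ 2)%:E) `^ 2^-1)%E.
Proof.
rewrite unlock; congr (_ `^ _)%E; apply: eq_integral => x _.
by rewrite abse_EFin poweR_EFin powR_mulrn// real_normK// num_real.
Qed.

Lemma sqr_Lnorm2 (f : T -> R) :
  ('N[mu]_(2%:E) [EFin \o f] ^+ 2 = \int[mu]_x (f x ^+ 2)%:E)%E.
Proof.
have I0 : (0 <= \int[mu]_x (f x ^+ 2)%:E)%E.
  by apply: integral_ge0 => x _; rewrite lee_fin sqr_ge0.
rewrite Lnorm2E; case: (\int[mu]_x _)%E I0 => [r| |]//; last first.
  by move=> _; rewrite poweRyr ?invr_eq0//= expe2 mulyy.
rewrite lee_fin => r0; rewrite poweR_EFin -EFin_expe.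
by rewrite -powR_mulrn ?powR_ge0// -powRrM mulVf// powRr1.
Qed.

(** [G] is the Gram matrix of the family. The same expansion serves white noise, indicators and
    Fourier modes. *)
Lemma integral_sqr_sum (I : Type) (s : seq I) (F : I -> T -> R)
    (G : I -> I -> R) :
  (forall i j, mu.-integrable setT (EFin \o (fun x => F i x * F j x))) ->
  (forall i j, \int[mu]_x (F i x * F j x)%:E = (G i j)%:E)%E ->
  (\int[mu]_x ((\sum_(i <- s) F i x) ^+ 2)%:E =
   (\sum_(i <- s) \sum_(j <- s) G i j)%:E)%E.
Proof.
move=> iF IF.
transitivity (\int[mu]_x (\sum_(i <- s) \sum_(j <- s) (F i x * F j x)%:E))%E.
  apply: eq_integral => x _; rewrite expr2 mulr_suml -sumEFin.
  by apply: eq_bigr => i _; rewrite mulr_sumr -sumEFin.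
rewrite integral_sum//; last first.
  by move=> i; apply: integrable_sum => // j _; exact: iF.
rewrite -sumEFin; apply: eq_bigr => i _.
rewrite integral_sum//; last by move=> j; exact: iF.
by rewrite -sumEFin; apply: eq_bigr => j _; exact: IF.
Qed.

Lemma integrable_mul_sqr (f g : T -> R) :
  measurable_fun setT f -> measurable_fun setT g ->
  (\int[mu]_x (f x ^+ 2)%:E < +oo)%E -> (\int[mu]_x (g x ^+ 2)%:E < +oo)%E ->
  mu.-integrable setT (EFin \o (fun x => f x * g x)).
Proof.
have isq (h : T -> R) : measurable_fun setT h ->
    (\int[mu]_x (h x ^+ 2)%:E < +oo)%E ->
    mu.-integrable setT (EFin \o (fun x => h x ^+ 2)).
  move=> mh hoo; apply/integrableP; split.
    by apply/measurable_EFinP; exact: measurable_funX.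
  rewrite (eq_integral (fun x => (h x ^+ 2)%:E))// => x _ /=.
  by rewrite ger0_norm// sqr_ge0.
move=> mf mg foo goo.
apply: (@le_integrable _ _ _ _ _ _ _
  ((EFin \o (fun x => (f x ^+ 2)%R)) \+ (EFin \o (fun x => (g x ^+ 2)%R)))%E) => //.
- by apply/measurable_EFinP; exact: measurable_funM.
- move=> x _ /=; rewrite lee_fin [leRHS]ger0_norm ?addr_ge0 ?sqr_ge0// normrM.
  rewrite -(real_normK (num_real (f x))) -(real_normK (num_real (g x))).
  have := sqr_ge0 (`|f x| - `|g x|); have := sqr_ge0 (`|f x| + `|g x|); nra.
- by apply: integrableD => //; exact: isq.
Qed.

Lemma integrable_bounded (f : T -> R) (M : R) : (mu setT < +oo)%E ->
  measurable_fun setT f -> (forall x, `|f x| <= M) ->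
  mu.-integrable setT (EFin \o f).
Proof.
move=> muoo mf fM; apply: measurable_bounded_integrable => //.
exists M; split; first exact: num_real.
by move=> x Mx y _ /=; rewrite (le_trans (fM y))// ltW.
Qed.

Lemma Lnorm2B (f g : T -> R) :
  ('N[mu]_(2%:E) [EFin \o (fun x => (f x - g x)%R)] =
   'N[mu]_(2%:E) [EFin \o (fun x => (g x - f x)%R)])%E.
Proof.
by rewrite !Lnorm2E; congr (_ `^ _)%E; apply: eq_integral => x _;
  rewrite -sqrrN opprB.
Qed.

Lemma Lnorm2_triangle (f g h : T -> R) :
  measurable_fun setT f -> measurable_fun setT g -> measurable_fun setT h ->
  ('N[mu]_(2%:E) [EFin \o (fun x => (f x - h x)%R)] <=
   'N[mu]_(2%:E) [EFin \o (fun x => (f x - g x)%R)] +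
   'N[mu]_(2%:E) [EFin \o (fun x => (g x - h x)%R)])%E.
Proof.
move=> mf mg mh.
have -> : (fun x => f x - h x) = ((fun x => f x - g x) \+ (fun x => g x - h x)).
  by apply/funext => x /=; rewrite subrKA.
by apply: minkowski_EFin; [exact: measurable_funB|exact: measurable_funB|lra].
Qed.

(** The roles of limit and approximant are interchangeable here, so the isometry can go from the
    limits to simple functions and back. *)
Lemma Lnorm2_perturb (f f' g g' : T -> R) :
  measurable_fun setT f -> measurable_fun setT f' ->
  measurable_fun setT g -> measurable_fun setT g' ->
  ('N[mu]_(2%:E) [EFin \o (fun x => (f x - g x)%R)] <=
   'N[mu]_(2%:E) [EFin \o (fun x => (f' x - f x)%R)] +
   'N[mu]_(2%:E) [EFin \o (fun x => (f' x - g' x)%R)] +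
   'N[mu]_(2%:E) [EFin \o (fun x => (g' x - g x)%R)])%E.
Proof.
move=> mf mf' mg mg'.
apply: (le_trans (Lnorm2_triangle mf mf' mg)).
rewrite -addeA Lnorm2B; apply: leeD => //.
exact: Lnorm2_triangle.
Qed.

End square_integrals.

Lemma lee_of_cvg0 {R : realType} (x y : \bar R) (u v : nat -> \bar R) :
  (u n @[n --> \oo] --> 0)%E -> (v n @[n --> \oo] --> 0)%E ->
  (forall n, x <= u n + y + v n)%E -> (x <= y)%E.
Proof.
move=> u0 v0 H.
(* Infinite [y] is settled first: the limit of the sum is then taken with [y] finite, where no oo -
   oo arises. *)
case: y H => [y| |] H; last 2 first.
- by rewrite leey.
- have := H 0%N.
  case: (u 0%N) => [?| |]; case: (v 0%N) => [?| |]//=; by rewrite ?addeNy ?addNye.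
have -> : (y%:E = 0 + y%:E + 0)%E by rewrite adde0 add0e.
apply: (@cvge_ge _ \oo _ _ (fun n => u n + y%:E + v n)%E).
- by apply: nearW => n; exact: H.
- apply: cvgeD => //; apply: cvgeD => //; exact: cvg_cst.
Qed.

(** * The Wiener integral is an L2 isometry *)

Section wiener_isometry.
Context {R : realType} {d d' : measure_display}.
Context {S : measurableType d} {Omega : measurableType d'}.
Variables (mu : {measure set S -> \bar R}) (P : probability Omega R).
Variable W : set S -> {RV P >-> R}.
Hypotheses (mu_fin : (mu setT < +oo)%E) (WN : is_white_noise mu W).

Let mu_lty A : measurable A -> (mu A < +oo)%E.
Proof.
by move=> mA; apply: le_lt_trans mu_fin; apply: le_measure; rewrite ?inE.
Qed.

Let covW A B : measurable A -> measurable B ->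
  (\int[P]_w (W A w * W B w)%:E = mu (A `&` B))%E.
Proof.
move=> mA mB; rewrite -(white_noise_covariance WN mA mB (mu_lty mA) (mu_lty mB)).
by rewrite unlock.
Qed.

(** Both sides expand to the same Gram matrix: a_i a_j times the measure of the intersection of A_i
    and A_j. *)
Lemma white_noise_isometry (I : Type) (s : seq I) (a : I -> R)
    (A : I -> set S) : (forall i, measurable (A i)) ->
  (\int[P]_w ((\sum_(i <- s) a i * W (A i) w) ^+ 2)%:E =
   \int[mu]_z ((\sum_(i <- s) a i * \1_(A i) z) ^+ 2)%:E)%E.
Proof.
move=> mA.
pose G i j := a i * a j * fine (mu (A i `&` A j)).
have muE i j : ((fine (mu (A i `&` A j)))%:E = mu (A i `&` A j))%E.
  by rewrite fineK// ge0_fin_numE// mu_lty//; exact: measurableI.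
have sqW i : (\int[P]_w (W (A i) w ^+ 2)%:E < +oo)%E.
  by under eq_integral do rewrite expr2; rewrite covW// mu_lty//; exact: measurableI.
have iWW i j : P.-integrable setT (EFin \o (fun w => W (A i) w * W (A j) w)).
  exact: integrable_mul_sqr.
have iII i j : mu.-integrable setT (EFin \o (fun z => \1_(A i) z * \1_(A j) z : R)).
  apply: (@integrable_bounded _ _ _ _ _ 1) => //.
    exact: measurable_funM.
  move=> z; rewrite -[_ * _]/((\1_(A i) \* \1_(A j)) z) -indicI indicE.
  by case: (_ \in _); rewrite ?normr1 ?normr0.
rewrite (@integral_sqr_sum _ _ _ P _ _ (fun i w => a i * W (A i) w) G).
rewrite (@integral_sqr_sum _ _ _ mu _ _ (fun i z => a i * \1_(A i) z) G)//.
- move=> i j.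
  rewrite (_ : _ \o _ = (fun z => (a i * a j)%:E * (\1_(A i) z * \1_(A j) z)%:E)%E).
    exact: (integrableZl measurableT (a i * a j) (iII i j)).
  by apply/funext => z /=; rewrite -EFinM mulrACA.
- move=> i j; under eq_integral do rewrite mulrACA EFinM.
  rewrite (integralZl measurableT (iII i j)) /G [in RHS]EFinM muE; congr (_ * _)%E.
  under eq_integral do rewrite /= -[(_ * _)%R]/((\1_(A i) \* \1_(A j)) _) -indicI.
  by rewrite integral_indic ?setIT//; exact: measurableI.
- move=> i j.
  rewrite (_ : _ \o _ = (fun z => (a i * a j)%:E * (W (A i) z * W (A j) z)%:E)%E).
    exact: (integrableZl measurableT (a i * a j) (iWW i j)).
  by apply/funext => z /=; rewrite -EFinM mulrACA.
- move=> i j; under eq_integral do rewrite mulrACA EFinM.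
  by rewrite (integralZl measurableT (iWW i j)) /G [in RHS]EFinM muE covW.
Qed.

(** The level sets of [f] and [g] are put in one list, tagged by a boolean and signed. The list may
    contain overlapping sets, so neither a common refinement nor the additivity of [wiener_simple]
    has to be established. *)
Lemma wiener_simple_isometry (f g : {sfun S >-> R}) :
  (\int[P]_w ((wiener_simple W f w - wiener_simple W g w) ^+ 2)%:E =
   \int[mu]_z ((f z - g z) ^+ 2)%:E)%E.
Proof.
pose s := [seq (true, y) | y <- finmap.enum_fset (fset_set (range f))] ++
          [seq (false, y) | y <- finmap.enum_fset (fset_set (range g))].
pose a (p : bool * R) : R := if p.1 then p.2 else - p.2.
pose A (p : bool * R) := if p.1 then f @^-1` [set p.2] else g @^-1` [set p.2].
transitivity (\int[P]_w ((\sum_(i <- s) a i * W (A i) w) ^+ 2)%:E)%E.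
  apply: eq_integral => w _; congr (_ ^+ 2)%:E.
  rewrite /wiener_simple !fsbig_finite//= big_cat/= !big_map -sumrN.
  by congr (_ + _); apply: eq_bigr => y _; rewrite /a/A /= ?mulNr.
rewrite white_noise_isometry; last first.
  by case=> [[] y]; rewrite /A /=; exact: measurable_sfunP.
apply: eq_integral => z _; congr (_ ^+ 2)%:E.
rewrite [in RHS]fimfunE [in X in _ - X]fimfunE !fsbig_finite//= big_cat/= !big_map -sumrN.
by congr (_ + _); apply: eq_bigr => y _; rewrite /a/A /= ?mulNr.
Qed.

Lemma measurable_wiener_simple (f : {sfun S >-> R}) :
  measurable_fun setT (wiener_simple W f).
Proof.
rewrite /wiener_simple.
under eq_fun do rewrite fsbig_finite//=.
apply: measurable_sum => y; apply: measurable_funM => //.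
Qed.

(** Two inequalities between norms. Each passes from one side to the simple approximants, crosses by
    [iso], and passes to the limits on the other side; the four errors tend to 0. *)
Lemma wiener_isometry (f g : S -> R) (X Y : {RV P >-> R}) :
  measurable_fun setT f -> measurable_fun setT g ->
  is_wiener_integral mu W f X -> is_wiener_integral mu W g Y ->
  (L2_dist_sqr X Y = \int[mu]_z ((f z - g z) ^+ 2)%:E)%E.
Proof.
move=> mf mg [fn [fnf fnX]] [gn [gng gnY]].
have mW := measurable_wiener_simple.
have iso n : ('N[P]_(2%:E) [EFin \o (fun w => (wiener_simple W (fn n) w - wiener_simple W (gn n) w)%R)] =
     'N[mu]_(2%:E) [EFin \o (fun z => (fn n z - gn n z)%R)])%E.
  by rewrite !Lnorm2E wiener_simple_isometry.
have cvgD0 (u v : nat -> \bar R) : (u n @[n --> \oo] --> 0)%E ->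
    (v n @[n --> \oo] --> 0)%E -> (u n + v n @[n --> \oo] --> 0)%E.
  by move=> u0 v0; rewrite -[0%E]adde0; apply: cvgeD.
rewrite -sqr_Lnorm2 /L2_dist_sqr; congr (_ ^+ 2)%E; apply/eqP.
rewrite eq_le; apply/andP; split.
- have := lee_of_cvg0 (cvgD0 _ _ fnX fnf) (cvgD0 _ _ gnY gng); apply => n.
  apply: (le_trans (Lnorm2_perturb P _ (mW (fn n)) _ (mW (gn n)))) => //.
  rewrite iso [leRHS](AC (2*1*2) ((1*(2*3*5)*4)))/=.
  apply: leeD => //; apply: leeD => //.
  apply: (le_trans (Lnorm2_perturb mu _ mf _ mg)) => //.
  by rewrite Lnorm2B (Lnorm2B _ (gn n)).
- have := lee_of_cvg0 (cvgD0 _ _ fnf fnX) (cvgD0 _ _ gng gnY); apply => n.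
  apply: (le_trans (Lnorm2_perturb mu _ (measurable_funPT (fn n)) _ (measurable_funPT (gn n)))) => //.
  rewrite -iso [leRHS](AC (2*1*2) ((1*(2*3*5)*4)))/=.
  apply: leeD => //; apply: leeD => //.
  rewrite [X in (_ <= X + _ + _)%E]Lnorm2B [X in (_ <= _ + X)%E]Lnorm2B.
  exact: Lnorm2_perturb.
Qed.
End wiener_isometry.

Lemma finite_measure_lty {R : realType} (d : measure_display) (T : measurableType d)
    (m : {finite_measure set T -> \bar R}) : (m setT < +oo)%E.
Proof. by rewrite -ge0_fin_numE// fin_num_measure. Qed.

(** * Integrals over a compact interval *)

Section lebesgue_on_integral.
Context {R : realType}.
Local Notation leb := (@lebesgue_measure R).

(* [lebesgue_on] lives on the default measurable structure of [R] and
   [lebesgue_measure] on [measurableTypeR R]; the identity transports one to the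
   other. *)
Lemma integral_lebesgue_on (a b : R) (f : R -> \bar R) :
  (lebesgue_on a b).-integrable setT f ->
  (\int[lebesgue_on a b]_x f x = \int[leb]_(x in `[a, b]) f x)%E.
Proof.
move=> intf.
have mid : measurable_fun [set: R] (id : R -> measurableTypeR R).
  by move=> _ Y mY; rewrite setTI; exact: mY.
have mf : measurable_fun [set: measurableTypeR R] f.
  by move=> mT Y mY; have /integrableP[mf _] := intf; exact: mf.
pose m := pushforward (lebesgue_on a b) (id : R -> measurableTypeR R).
transitivity (\int[m]_x f x)%E.
  by rewrite (integral_pushforward mid mf).
have intmf : m.-integrable setT f.
  exact: (integrable_pushforward mid mf).
have mD : measurable (~` `[a, b]%classic : set (measurableTypeR R)).
  by apply: measurableC.
rewrite (@negligible_integral _ _ _ m setT (~` `[a, b]%classic))//; last first.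
  by rewrite /m /= /pushforward /= /lebesgue_on setICl measure0.
rewrite setTD setCK; apply: eq_measure_integral => A mA Aab /=.
by rewrite /m/= /pushforward /lebesgue_on/= setIidl.
Qed.

Lemma integrable_lebesgue_on (a b M : R) (f : R -> R) :
  measurable_fun setT f -> (forall x, `|f x| <= M) ->
  (lebesgue_on a b).-integrable setT (EFin \o f).
Proof. exact: (integrable_bounded (finite_measure_lty (lebesgue_on a b))). Qed.

Lemma integral_itv_antiderivative (F f : R -> R) (a b : R) : a <= b ->
  continuous f -> (forall x : R, is_derive x 1 F (f x)) ->
  (\int[leb]_(x in `[a, b]) (f x)%:E = (F b - F a)%:E)%E.
Proof.
rewrite le_eqVlt => /predU1P[<- _ _|ab cf dF].
  by rewrite set_itv1 integral_set1 subrr.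
have cF : continuous F.
  by move=> x; apply/differentiable_continuous/derivable1_diffP; exact: ex_derive.
rewrite EFinB; apply: (@continuous_FTC2 _ f F) => //.
- exact: continuous_subspaceT.
- split=> [x _| |]; first exact: ex_derive.
    by apply: cvg_at_right_filter; exact: cF.
  by apply: cvg_at_left_filter; exact: cF.
- by move=> x _; rewrite derive1E; exact: derive_val.
Qed.

End lebesgue_on_integral.

(** * Orthogonality of the cosines on a period *)

Section trigonometric_integrals.
Context {R : realType}.
Local Notation leb := (@lebesgue_measure R).

Lemma sinD2piMn (x : R) n : sin (x + n%:R * (2 * pi)) = sin x.
Proof.
by rewrite [2 * pi]mulr_natl mulr_natl (periodicn (@sinD2pi R)).
Qed.

Lemma cosD2piMn (x : R) n : cos (x + n%:R * (2 * pi)) = cos x.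
Proof.
by rewrite [2 * pi]mulr_natl mulr_natl (periodicn (@cosD2pi R)).
Qed.

Lemma continuous_cos_affine (b c : R) : continuous (fun z => cos (b + c * z)).
Proof.
move=> z; apply: (@continuous_comp _ _ _ (fun z : R => b + c * z) cos).
  by apply: cvgD; [exact: cvg_cst|apply: cvgM; [exact: cvg_cst|exact: cvg_id]].
exact: continuous_cos.
Qed.

Lemma integral_cos_affine (b : R) (n : nat) :
  (\int[lebesgue_on 0 (2 * pi)]_z (cos (b + n%:R * z))%:E =
   (if n == 0%N then 2 * pi * cos b else 0)%:E)%E.
Proof.
have cc := @continuous_cos_affine b n%:R.
have pi2 : 0 <= 2 * pi :> R by rewrite mulr_ge0// pi_ge0.
rewrite (@integral_lebesgue_on _ _ _ (fun z => (cos (b + n%:R * z))%:E)); last first.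
  apply: (@integrable_lebesgue_on _ _ _ 1) => [|z]; last exact: cos_max.
  exact: continuous_measurable_fun.
case: eqP => [n0|/eqP n0].
  have dF (x : R) : is_derive x 1 (fun z : R => z * cos b) (cos (b + n%:R * x)).
    rewrite n0 mul0r addr0; apply: is_derive_eq.
    by rewrite /GRing.scale/= mulr0 add0r mulr1.
  by rewrite (integral_itv_antiderivative pi2 cc dF) mul0r subr0.
have n0' : n%:R != 0 :> R by rewrite pnatr_eq0.
have dF (x : R) : is_derive x 1 (fun z : R => sin (b + n%:R * z) / n%:R) (cos (b + n%:R * x)).
  apply: is_derive_eq.
  by rewrite !scaler0 !add0r /GRing.scale/= mulr1 mul1r mulrC mulfK.
by rewrite (integral_itv_antiderivative pi2 cc dF) mulr0 addr0 sinD2piMn subrr.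
Qed.

Lemma cosM_half_sum (a b : R) : cos a * cos b = 2^-1 * (cos (a - b) + cos (a + b)).
Proof. by rewrite cosB cosD; field. Qed.

(* [2 ^+ (k == 0) * pi] is the squared L2 norm of [cos (k .)] on a period. *)
Lemma integral_cos_conv (x y : R) (k l : nat) :
  (\int[lebesgue_on 0 (2 * pi)]_z
     (cos (k%:R * (x - z)) * cos (l%:R * (y - z)))%:E =
   (if k == l then 2 ^+ (k == 0%N) * pi * cos (k%:R * (x - y)) else 0)%:E)%E.
Proof.
wlog kl : k l x y / (k <= l)%N.
  move=> H; have [|/ltnW] := leqP k l; first exact: H.
  move/H => {}H; under eq_integral do rewrite mulrC.
  rewrite H eq_sym; case: eqP => // ->.
  by rewrite -[in RHS]opprB mulrN cosN.
(* Phases of the half-sum formula. The second cosine is reflected so that both frequencies in z, l -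
   k and k + l, are natural numbers. *)
pose b1 := k%:R * x - l%:R * y; pose b2 := - (k%:R * x + l%:R * y).
have cE b n := @integral_cos_affine b n.
have ci (b : R) (n : nat) : (lebesgue_on 0 (2 * pi)).-integrable setT
    (EFin \o (fun z : R => cos (b + n%:R * z))).
  apply: (@integrable_lebesgue_on _ _ _ 1) => [|z]; last exact: cos_max.
  by apply: continuous_measurable_fun; exact: continuous_cos_affine.
transitivity (\int[lebesgue_on 0 (2 * pi)]_z
    ((2^-1)%:E * ((cos (b1 + (l - k)%:R * z))%:E + (cos (b2 + (k + l)%:R * z))%:E)))%E.
  apply: eq_integral => z _; rewrite -EFinD -EFinM cosM_half_sum; congr (_ * (_ + _))%:E.
    by congr cos; rewrite /b1 natrB//; ring.
  by rewrite -cosN; congr cos; rewrite /b2 natrD; ring.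
rewrite (integralZl measurableT (integrableD _ (ci b1 (l - k)%N) (ci b2 (k + l)%N)))//.
rewrite /= (integralD _ (ci b1 _) (ci b2 _))// !cE -EFinD -EFinM subn_eq0 addn_eq0.
congr (_%:E); case: (eqVneq k l) => [klE|kl'].
  rewrite /b1 /b2 -klE leqnn andbb -mulrBr cosN.
  case: (eqVneq k 0%N) => [->|k0] /=; last by field.
  by rewrite !mul0r addr0 cos0; field.
rewrite leqNgt ltn_neqAle kl' kl /=.
case: (eqVneq k 0%N) => [k0|_]; last by rewrite /= addr0 mulr0.
by case: (eqVneq l 0%N) => [l0|_]; [rewrite k0 l0 eqxx in kl'|rewrite /= addr0 mulr0].
Qed.
End trigonometric_integrals.

(** * Integrals of products of one-variable functions *)

Section product_integrals.
Context {R : realType}.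

Lemma product_measure_lty (d1 d2 : measure_display) (T1 : measurableType d1)
    (T2 : measurableType d2) (m1 : {finite_measure set T1 -> \bar R})
    (m2 : {finite_measure set T2 -> \bar R}) : ((m1 \x m2) setT < +oo)%E.
Proof.
rewrite -setXTT product_measure1E// lte_mul_pinfty//.
  by rewrite fin_num_measure.
exact: finite_measure_lty.
Qed.

Lemma integral_prod_mul (d1 d2 : measure_display) (T1 : measurableType d1)
    (T2 : measurableType d2) (m1 : {finite_measure set T1 -> \bar R})
    (m2 : {finite_measure set T2 -> \bar R}) (f : T1 -> R) (g : T2 -> R)
    (M N a b : R) :
  measurable_fun setT f -> measurable_fun setT g ->
  (forall x, `|f x| <= M) -> (forall x, `|g x| <= N) ->
  (\int[m1]_x (f x)%:E = a%:E)%E -> (\int[m2]_x (g x)%:E = b%:E)%E ->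
  (\int[m1 \x m2]_z (f z.1 * g z.2)%:E = (a * b)%:E)%E.
Proof.
move=> mf mg fM gN fa gb.
have fin1 := finite_measure_lty m1; have fin2 := finite_measure_lty m2.
have intf := integrable_bounded fin1 mf fM.
have intg := integrable_bounded fin2 mg gN.
have mfg : measurable_fun setT (fun z : T1 * T2 => f z.1 * g z.2).
  by apply: measurable_funM; exact: measurableT_comp.
have intfg : (m1 \x m2)%E.-integrable setT (EFin \o (fun z => f z.1 * g z.2)).
  apply: (@integrable_bounded _ _ _ _ _ (M * N) (product_measure_lty m1 m2)) => // z.
  by rewrite normrM ler_pM.
rewrite -(integral12_prod_meas1 intfg) /fubini_F /=.
transitivity (\int[m1]_x ((f x)%:E * b%:E))%E.
  apply: eq_integral => x _; under eq_integral do rewrite EFinM.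
  by rewrite (integralZl measurableT intg) gb.
by rewrite (integralZr measurableT intf) fa.
Qed.

(** Induction along the recursive definition of [torus_measure]. The bound 1 is stable under
    products, so it supplies integrability at every stage. *)
Lemma integral_torus_prod (d : nat) (phi : 'I_d -> R -> R) (v : 'I_d -> R) :
  (forall j, measurable_fun setT (phi j)) ->
  (forall j x, `|phi j x| <= 1) ->
  (forall j, \int[lebesgue_on 0 (2 * pi)]_x (phi j x)%:E = (v j)%:E)%E ->
  (\int[torus_measure d]_z (\prod_(j < d) phi j (tnth z j))%:E =
   (\prod_(j < d) v j)%:E)%E.
Proof.
elim: d phi v => [|d IH] phi v mphi phi1 vE.
  rewrite big_ord0 /=; under eq_integral do rewrite big_ord0.
  by rewrite integral_cst//= diracT mul1e.
have mprod n (psi : 'I_n -> R -> R) : (forall j, measurable_fun setT (psi j)) ->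
    measurable_fun setT (fun z : n.-tuple R => \prod_(j < n) psi j (tnth z j)).
  move=> mpsi; apply: measurable_prod => j _.
  by apply: measurableT_comp => //; exact: measurable_tnth.
have bprod n (psi : 'I_n -> R -> R) : (forall j x, `|psi j x| <= 1) ->
    forall z : n.-tuple R, `|\prod_(j < n) psi j (tnth z j)| <= 1.
  move=> psi1 z; rewrite normr_prod; apply: prodr_ile1 => j _.
  by rewrite normr_ge0 psi1.
have finp := product_measure_lty (lebesgue_on 0 (2 * pi)) (@torus_measure R d).
rewrite /= /cons_measure integral_pushforward//=; last 2 first.
- by apply/measurable_EFinP; exact: mprod.
- apply: (@integrable_bounded _ _ _ _ _ 1) => //.
    apply: (@measurableT_comp _ _ _ _ _ _ (fun z => \prod_(j < d.+1) phi j (tnth z j))) => //.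
    exact: mprod.
  by move=> z; exact: bprod.
rewrite big_ord_recl.
rewrite -(integral_prod_mul (mphi ord0) (mprod _ (fun j => phi (lift ord0 j)) _)
   (phi1 _) (bprod _ (fun j => phi (lift ord0 j)) _) (vE _) (IH (fun j => phi (lift ord0 j)) _ _ _ _))//.
apply: eq_integral => z _; rewrite big_ord_recl /= ; congr (_ * _)%:E.
by apply: eq_bigr => j _; rewrite tnthS.
Qed.

End product_integrals.

(** * Space-time modes and their Gram matrix *)

Section modes.
Context {R : realType}.
Local Notation leb := (@lebesgue_measure R).

(** Half-open at [t]: at r = t the Green series diverges and [green] is 0 by convention. The modes
    vanish there too, so their sums converge at every point. *)
Definition time_factor (l t r : R) : R :=
  \1_(`[0, t[%classic) r * expR (- l * (t - r)).

Lemma measurable_time_factor l t : measurable_fun setT (time_factor l t).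
Proof.
apply: measurable_funM.
  by apply: measurable_indic; exact: measurable_itv.
apply: measurableT_comp => //; apply: measurable_funM => //.
by apply: measurable_funB.
Qed.

Lemma time_factor_ge0 l t r : 0 <= time_factor l t r.
Proof. by rewrite mulr_ge0 ?expR_ge0// indicE. Qed.

Lemma time_factor_le1 l t r : 0 <= l -> time_factor l t r <= 1.
Proof.
move=> l0; rewrite /time_factor indicE mem_setE in_itv /=.
case: andP => [[_ rt]|_]; last by rewrite mul0r.
by rewrite mul1r -expR0 ler_expR mulNr oppr_le0 mulr_ge0// subr_ge0 ltW.
Qed.

Lemma time_factor_norm l t r : 0 <= l -> `|time_factor l t r| <= 1.
Proof. by move=> l0; rewrite ger0_norm ?time_factor_ge0 ?time_factor_le1. Qed.

(** Covariance of the Ornstein-Uhlenbeck process of rate [l] started at 0; for l = 0 this is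
    Brownian motion, the limit of the second formula. *)
Definition time_cov (l t s : R) : R :=
  if l == 0 then Num.min t s
  else (expR (- l * `|t - s|) - expR (- l * (t + s))) / (2 * l).

Lemma time_cov_sym l t s : time_cov l t s = time_cov l s t.
Proof. by rewrite /time_cov minC distrC [t + s]addrC. Qed.

Lemma integral_time_factor (T l t s : R) : 0 <= l -> 0 <= t <= T -> 0 <= s <= T ->
  (\int[lebesgue_on 0 T]_r (time_factor l t r * time_factor l s r)%:E =
   (time_cov l t s)%:E)%E.
Proof.
wlog ts : t s / t <= s.
  move=> H l0 tT sT; have [ts|/ltW ts] := leP t s; first exact: H.
  under eq_integral do rewrite mulrC.
  by rewrite H// time_cov_sym.
move=> l0 /andP[t0 tT] /andP[s0 sT].
pose h r : R := expR (- l * (t - r)) * expR (- l * (s - r)).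
pose F r : R := if l == 0 then r else h r / (2 * l).
rewrite (@integral_lebesgue_on _ _ _ (fun r => (time_factor l t r * time_factor l s r)%:E)); last first.
  apply: (@integrable_lebesgue_on _ _ _ 1).
    by apply: measurable_funM; exact: measurable_time_factor.
  by move=> r; rewrite normrM mulr_ile1// time_factor_norm.
have ch : continuous h.
  have ce (u : R) : continuous (fun r : R => expR (- l * (u - r))).
    move=> r; apply: (@continuous_comp _ _ _ (fun r : R => - l * (u - r)) expR).
      by apply: cvgM; [exact: cvg_cst|apply: cvgB; [exact: cvg_cst|exact: cvg_id]].
    exact: continuous_expR.
  by move=> r; apply: cvgM; exact: ce.
(* As t <= s, the product of the two factors lives on [0, t[, where it equals [h]. *)
transitivity (\int[leb]_(r in `[0%R, T]) (((fun r => (h r)%:E) \_ `[0%R, t[%classic) r))%E.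
  apply: eq_integral => r _; rewrite patchE /time_factor !indicE !mem_setE !in_itv /=.
  case: ifPn => [/andP[-> rt]|]; last by rewrite !mul0r.
  by rewrite (lt_le_trans rt ts) !mul1r.
rewrite -integral_mkcondr.
have -> : `[0%R, T]%classic `&` `[0%R, t[%classic = `[0%R, t[%classic :> set R.
  rewrite setIidr// => r /=; rewrite !in_itv/= => /andP[-> /ltW rt].
  exact: le_trans tT.
rewrite integral_itv_bndo_bndc; last first.
  apply: measurable_funTS; apply: (@measurableT_comp _ _ _ _ _ _ EFin _ h) => //.
  exact: (continuous_measurable_fun ch).
have dF (x : R) : is_derive x 1 F (h x).
  rewrite /F /h; case: eqP => [->|/eqP l1].
    by rewrite oppr0 !mul0r expR0 mulr1; exact: is_derive_id.
  apply: is_derive_eq.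
  rewrite /GRing.scale/= ; by field.
rewrite (integral_itv_antiderivative t0 ch dF) /F /time_cov /h.
congr (_%:E); case: eqP => [_|/eqP l1]; first by rewrite subr0 min_l.
rewrite -!expRD ler0_norm ?subr_le0// -mulrBl.
by congr ((expR _ - expR _) / _); ring.
Qed.

(** Second moment of the difference of two such processes at times [t] and [s], the cross term being
    damped by the spatial correlation [c]. *)
Definition mode_var (l c t s : R) : R :=
  time_cov l t t + time_cov l s s - 2 * (time_cov l t s * c).

Section dimension.
Variable d : nat.
Implicit Types x y : d.-tuple R.

Lemma lambda_ge0 (k : 'I_d -> nat) : 0 <= lambda k :> R.
Proof. by apply: sumr_ge0 => j _; rewrite exprn_ge0. Qed.

(** Inverse of the squared L2 norm over the torus of the cosine product of frequency [k]: a null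
    component gives 2 pi, any other one pi. *)
Definition mode_weight (k : 'I_d -> nat) : R := (2 ^+ null_components k * pi ^+ d)^-1.

Lemma mode_weight_gt0 k : 0 < mode_weight k.
Proof. by rewrite invr_gt0 mulr_gt0// exprn_gt0// pi_gt0. Qed.

Definition mode (t : R) x (k : 'I_d -> nat) (z : R * d.-tuple R) : R :=
  mode_weight k * (time_factor (lambda k) t z.1 *
    \prod_(j < d) cos ((k j)%:R * (tnth x j - tnth z.2 j))).

Definition mode_cos (k : 'I_d -> nat) x y : R :=
  \prod_(j < d) cos ((k j)%:R * (tnth x j - tnth y j)).

Lemma measurable_cos_comp (c b : R) : measurable_fun setT (fun z : R => cos (c * (b - z))).
Proof.
apply: continuous_measurable_fun => z.
have -> : (fun z : R => cos (c * (b - z))) = (fun z : R => cos (c * b + (- c) * z)).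
  by apply/funext => u; congr cos; ring.
exact: continuous_cos_affine.
Qed.

Lemma measurable_cos_prod (k : 'I_d -> nat) x :
  measurable_fun setT (fun z : d.-tuple R =>
    \prod_(j < d) cos ((k j)%:R * (tnth x j - tnth z j))).
Proof.
apply: measurable_prod => j _.
apply: (@measurableT_comp _ _ _ _ _ _ (fun z : R => cos ((k j)%:R * (tnth x j - z)))).
  exact: measurable_cos_comp.
exact: measurable_tnth.
Qed.

Lemma measurable_mode t x k : measurable_fun setT (mode t x k).
Proof.
apply: measurable_funM => //; apply: measurable_funM.
  by apply: measurableT_comp => //; exact: measurable_time_factor.
by apply: (measurableT_comp (measurable_cos_prod k x)).
Qed.

Lemma norm_cos_prod_le1 (k : 'I_d -> nat) (b : 'I_d -> R) :
  `|\prod_(j < d) cos ((k j)%:R * b j)| <= 1.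
Proof.
by rewrite normr_prod; apply: prodr_ile1 => j _; rewrite normr_ge0 cos_max.
Qed.

Lemma norm_mode_le t x k z : `|mode t x k z| <= mode_weight k.
Proof.
rewrite /mode normrM (gtr0_norm (mode_weight_gt0 k)).
rewrite ler_piMr ?(ltW (mode_weight_gt0 k))// normrM.
by rewrite mulr_ile1 ?time_factor_norm ?lambda_ge0 ?norm_cos_prod_le1.
Qed.

Lemma spacetime_measure_lty (T : R) : (spacetime_measure T d setT < +oo)%E.
Proof. exact: product_measure_lty. Qed.

Lemma integral_mode_mul (N : nat) (T t s : R) x y (k l : {ffun 'I_d -> 'I_N}) :
  0 <= t <= T -> 0 <= s <= T ->
  (\int[spacetime_measure T d]_z (mode t x (fun j => k j) z * mode s y (fun j => l j) z)%:E =
   (if k == l then mode_weight (fun j => k j) * (time_cov (lambda (fun j => k j : nat)) t s *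
      mode_cos (fun j => k j) x y) else 0)%:E)%E.
Proof.
move=> tT sT.
pose tf r := time_factor (lambda (fun j => k j : nat)) t r *
  time_factor (lambda (fun j => l j : nat)) s r.
pose sp (z : d.-tuple R) := \prod_(j < d) (cos ((k j)%:R * (tnth x j - tnth z j)) *
   cos ((l j)%:R * (tnth y j - tnth z j))).
pose v j : R := if (k j : nat) == l j then 2 ^+ ((k j : nat) == 0%N) * pi *
   cos ((k j)%:R * (tnth x j - tnth y j)) else 0.
(* The time integral has the closed form [time_cov] for equal decay rates. For k != l it stays
   abstract, because the spatial factor vanishes. *)
pose a : R := fine (\int[lebesgue_on 0 T]_r (tf r)%:E)%E.
have mtf : measurable_fun setT tf.
  by apply: measurable_funM; exact: measurable_time_factor.
have btf r : `|tf r| <= 1.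
  by rewrite normrM mulr_ile1// time_factor_norm// lambda_ge0.
have aE : (\int[lebesgue_on 0 T]_r (tf r)%:E = a%:E)%E.
  rewrite fineK//; apply: integrable_fin_num => //.
  exact: integrable_lebesgue_on.
have msp : measurable_fun setT sp.
  rewrite /sp; under eq_fun do rewrite big_split.
  by apply: measurable_funM; exact: measurable_cos_prod.
have bsp z : `|sp z| <= 1.
  by rewrite /sp big_split normrM mulr_ile1// norm_cos_prod_le1.
have vE : (\int[torus_measure d]_z (sp z)%:E = (\prod_(j < d) v j)%:E)%E.
  apply: (@integral_torus_prod _ _ (fun j (z : R) => cos ((k j)%:R * (tnth x j - z)) *
   cos ((l j)%:R * (tnth y j - z)))).
  - by move=> j; apply: measurable_funM; exact: measurable_cos_comp.
  - by move=> j z; rewrite normrM mulr_ile1// cos_max.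
  - by move=> j; rewrite integral_cos_conv.
have prodE := integral_prod_mul mtf msp btf bsp aE vE.
have intp : (spacetime_measure T d).-integrable setT
    (EFin \o (fun z : R * d.-tuple R => tf z.1 * sp z.2)).
  apply: (@integrable_bounded _ _ _ _ _ 1 (spacetime_measure_lty T)).
    by apply: measurable_funM; exact: measurableT_comp.
  by move=> z; rewrite normrM mulr_ile1.
transitivity (\int[spacetime_measure T d]_z
   ((mode_weight (fun j => k j) * mode_weight (fun j => l j))%:E * (tf z.1 * sp z.2)%:E))%E.
  apply: eq_integral => z _; rewrite -EFinM; congr _%:E.
  by rewrite /mode /tf /sp big_split/=; ring.
rewrite (integralZl measurableT intp) prodE -EFinM; congr _%:E.
case: eqP => [kl|/eqP kl].
  have -> : a = time_cov (lambda (fun j => k j : nat)) t s.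
    apply/EFin_inj; rewrite -aE -(integral_time_factor (lambda_ge0 _) tT sT).
    by rewrite /tf -kl.
  have -> : \prod_(j < d) v j = (mode_weight (fun j => k j))^-1 * mode_cos (fun j => k j) x y.
    rewrite /v -kl; under eq_bigr do rewrite eqxx.
    rewrite big_split/=; congr (_ * _).
    rewrite /mode_weight invrK big_split/= prodr_const card_ord; congr (_ * _).
    rewrite prodrXr /null_components -sum1_card [in RHS]big_mkcond/=.
    by congr (_ ^+ _); apply: eq_bigr => j _; rewrite inE; case: (_ == 0%N).
  have := mode_weight_gt0 (fun j => k j); rewrite -kl => w0.
  by field; rewrite gt_eqF.
have [j klj] : exists j, k j != l j.
  by apply/existsP; apply: contra_neqT kl; rewrite negb_exists => /forallP H;
    apply/ffunP => j; apply/eqP; rewrite -[_ == _]negbK.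
by rewrite (bigD1 j)//= /v (negbTE (klj : (k j : nat) != l j)) mul0r !mulr0.
Qed.

Definition mode_dist (t s : R) x y (k : 'I_d -> nat) : R :=
  mode_weight k * mode_var (lambda k) (mode_cos k x y) t s.

Lemma mode_cosxx k x : mode_cos k x x = 1.
Proof. by rewrite /mode_cos big1// => j _; rewrite subrr mulr0 cos0. Qed.

Lemma mode_cos_sym k x y : mode_cos k x y = mode_cos k y x.
Proof.
by apply: eq_bigr => j _; rewrite -[tnth x j - _]opprB mulrN cosN.
Qed.

(** The predicate [Q] covers both a full cube and the difference of two cubes; the latter gives the
    Cauchy estimate of the partial sums. *)
Lemma integral_sqr_sum_modes (N : nat) (T t s : R) x y (Q : pred {ffun 'I_d -> 'I_N}) :
  0 <= t <= T -> 0 <= s <= T ->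
  (\int[spacetime_measure T d]_z ((\sum_(k : {ffun 'I_d -> 'I_N} | Q k)
     (mode t x (fun j => k j) z - mode s y (fun j => k j) z)) ^+ 2)%:E =
   (\sum_(k : {ffun 'I_d -> 'I_N} | Q k) mode_dist t s x y (fun j => k j))%:E)%E.
Proof.
move=> tT sT.
have fin := spacetime_measure_lty T.
have imm t' x' k' t'' x'' k'' : (spacetime_measure T d).-integrable setT
    (EFin \o (fun z => mode t' x' k' z * mode t'' x'' k'' z)).
  apply: (@integrable_bounded _ _ _ _ _ (mode_weight k' * mode_weight k'') fin).
    by apply: measurable_funM; exact: measurable_mode.
  by move=> z; rewrite normrM ler_pM// norm_mode_le.
under eq_integral do rewrite -big_filter.
rewrite (@integral_sqr_sum _ _ _ (spacetime_measure T d) _ _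
  (fun (k : {ffun 'I_d -> 'I_N}) z => mode t x (fun j => k j) z - mode s y (fun j => k j) z)
  (fun k l : {ffun 'I_d -> 'I_N} => if k == l then mode_dist t s x y (fun j => k j) else 0)).
- congr _%:E; rewrite -[RHS]big_filter; apply: eq_big_seq => k kin.
  rewrite (bigD1_seq k) ?filter_uniq ?index_enum_uniq//= eqxx big1 ?addr0//.
  by move=> l; rewrite eq_sym => /negbTE ->.
- move=> k l.
  apply: (@integrable_bounded _ _ _ _ _ ((mode_weight (fun j => k j) + mode_weight (fun j => k j)) *
     (mode_weight (fun j => l j) + mode_weight (fun j => l j))) fin).
    by apply: measurable_funM; apply: measurable_funB; exact: measurable_mode.
  move=> z; rewrite normrM ler_pM//;
    by rewrite (le_trans (ler_normB _ _))// lerD// norm_mode_le.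
- move=> k l.
  transitivity (\int[spacetime_measure T d]_z
     (((mode t x (fun j => k j) z * mode t x (fun j => l j) z)%:E -
       (mode t x (fun j => k j) z * mode s y (fun j => l j) z)%:E) -
      ((mode s y (fun j => k j) z * mode t x (fun j => l j) z)%:E -
       (mode s y (fun j => k j) z * mode s y (fun j => l j) z)%:E)))%E.
    by apply: eq_integral => z _; rewrite -!EFinB; congr _%:E; ring.
  rewrite (integralB measurableT (integrableB _ (imm _ _ _ _ _ _) (imm _ _ _ _ _ _))
     (integrableB _ (imm _ _ _ _ _ _) (imm _ _ _ _ _ _)))//.
  rewrite (integralB measurableT (imm _ _ _ _ _ _) (imm _ _ _ _ _ _)).
  rewrite (integralB measurableT (imm _ _ _ _ _ _) (imm _ _ _ _ _ _)).
  rewrite !integral_mode_mul// -!EFinB; congr _%:E.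
  case: eqP => [_|_]; last by rewrite !subr0.
  rewrite !mode_cosxx (mode_cos_sym _ y x) (time_cov_sym _ s t) /mode_dist /mode_var.
  by ring.
Qed.

End dimension.
End modes.

(** * Sums over cubes of frequencies, cut into shells *)

Section cube_sums.
Context {R : realType}.
Variable d : nat.
Implicit Type F : ('I_d -> nat) -> R.

Definition cube_sum (N : nat) F : R :=
  \sum_(k : {ffun 'I_d -> 'I_N}) F (fun j => k j : nat).

Lemma cube_sum_widen (N M : nat) F : (N <= M)%N ->
  cube_sum N F = \sum_(k : {ffun 'I_d -> 'I_M} | [forall j, (k j < N)%N]) F (fun j => k j : nat).
Proof.
move=> NM.
pose h (k : {ffun 'I_d -> 'I_N}) := [ffun j => widen_ord NM (k j)].
have hinj : injective h.
  move=> k l /ffunP kl; apply/ffunP => j; apply/val_inj.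
  by have := kl j; rewrite !ffunE => /(congr1 val).
transitivity (\sum_(k in h @: [set: {ffun 'I_d -> 'I_N}]%SET) F (fun j => k j : nat)).
  rewrite big_imset/=; last by move=> ? ? _ _; exact: hinj.
  apply: eq_big => [k|k _]; first by rewrite inE.
  by congr F; apply/funext => j; rewrite ffunE.
apply: eq_bigl => k; apply/imsetP/forallP => [[l _ ->] j|H]; first by rewrite ffunE /=.
exists [ffun j => Ordinal (H j)] => //.
by apply/ffunP => j; apply/val_inj; rewrite !ffunE.
Qed.

Lemma ler_cube_sum (N M : nat) F : (N <= M)%N -> (forall k, 0 <= F k) ->
  cube_sum N F <= cube_sum M F.
Proof.
move=> NM F0; rewrite (cube_sum_widen _ NM) /cube_sum big_mkcond.
by apply: ler_sum => k _; case: ifP.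
Qed.

(** The coordinate [j] carrying the maximum is prescribed, which makes the shell a product set with
    an exact cardinality. Shells of different [j] overlap where the maximum is attained twice. *)
Definition shell (N : nat) (j : 'I_d) (m : nat) : pred {ffun 'I_d -> 'I_N} :=
  fun k => ((k j : nat) == m) && [forall i, (k i <= m)%N].

Lemma card_shell (N : nat) (j : 'I_d) (m : nat) : (m < N)%N ->
  #|[pred k : {ffun 'I_d -> 'I_N} | shell j m k]| = (m.+1 ^ d.-1)%N.
Proof.
move=> mN.
pose A (i : 'I_d) : {pred 'I_N} :=
  if i == j then pred1 (Ordinal mN) else [pred a : 'I_N | (a < m.+1)%N].
rewrite (eq_card (B := mem (family A))); last first.
  move=> k; apply/idP/familyP => [/andP[/eqP kj /forallP km] i|kA].
    rewrite /A; case: eqP => [->|_]; first by apply/eqP/val_inj.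
    by rewrite inE ltnS.
  rewrite !inE /shell.
  have kj : (k j : nat) = m by have := kA j; rewrite /A eqxx => /eqP ->.
  rewrite kj eqxx; apply/forallP => i; have := kA i; rewrite /A.
  by case: eqP => [->|_]; rewrite ?kj// inE ltnS.
rewrite card_family foldrE big_map big_enum/= (bigD1 j)//= /A eqxx card1 mul1n.
rewrite (eq_bigr (fun=> m.+1)); last first.
  move=> i /negbTE ->; rewrite -sum1_card.
  by rewrite -(big_ord_widen N (fun=> 1%N) mN) sum1_card card_ord.
by rewrite prod_nat_const cardC1 card_ord.
Qed.

(* [B 0] bounds the term of the null frequency. *)
Lemma cube_sum_le_shells (N : nat) F (B : nat -> R) : (0 < d)%N ->
  (forall m, 0 <= B m) ->
  (forall k j, (forall i, (k i <= k j)%N) -> F k <= B (k j)) ->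
  cube_sum N F <= d%:R * \sum_(m < N) (m.+1 ^ d.-1)%:R * B m.
Proof.
move=> d0 B0 FB.
have -> : d%:R * \sum_(m < N) (m.+1 ^ d.-1)%:R * B m =
    \sum_(j < d) \sum_(m < N) \sum_(k : {ffun 'I_d -> 'I_N} | shell j m k) B m.
  transitivity (\sum_(j < d) \sum_(m < N) (m.+1 ^ d.-1)%:R * B m).
    by rewrite sumr_const card_ord mulr_natl.
  apply: eq_bigr => j _; apply: eq_bigr => m _.
  by rewrite sumr_const card_shell// mulr_natl.
(* With the sum over [k] outermost, each [k] collects a term from every coordinate attaining its
   maximum; one of them already dominates [F k]. *)
under eq_bigr do rewrite (exchange_big_dep xpredT)//=.
rewrite exchange_big/=; apply: ler_sum => k _.
have [j _ jmax] : exists2 j, true & forall i, (k i <= k j)%N.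
  have [j _ H] := @arg_maxnP _ (Ordinal d0) xpredT (fun i => k i : nat) erefl.
  by exists j => // i; exact: H.
rewrite (bigD1 j)//= (bigD1 (k j))/=; last first.
  by rewrite /shell eqxx/=; apply/forallP.
rewrite -addrA; apply: (le_trans (FB _ j jmax)); rewrite lerDl addr_ge0//.
  by apply: sumr_ge0.
by apply: sumr_ge0 => i _; apply: sumr_ge0.
Qed.

(** A single coordinate [j] is used, so the shells are disjoint and no frequency is counted
    twice. *)
Lemma cube_sum_ge_shells (N : nat) F (B : nat -> R) (j : 'I_d) :
  (forall k, 0 <= F k) ->
  (forall k, (forall i, (k i <= k j)%N) -> B (k j) <= F k) ->
  \sum_(m < N) (m.+1 ^ d.-1)%:R * B m <= cube_sum N F.
Proof.
move=> F0 FB.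
rewrite /cube_sum (partition_big (fun k : {ffun 'I_d -> 'I_N} => k j) xpredT)//=.
apply: ler_sum => m _.
rewrite -(card_shell j (ltn_ord m)) mulr_natl -sumr_const big_mkcond [leRHS]big_mkcond /=.
apply: ler_sum => k _; rewrite inE /shell -val_eqE.
case: ifPn => [/andP[/eqP kj /forallP H]|_]; last by case: ifP.
case: eqP => [_|/(_ kj)//].
by rewrite -kj; apply: (FB (fun i => k i : nat)) => i; rewrite kj; exact: H.
Qed.

(* [F = (F + G) - G] is a difference of two series with nonnegative terms and
   bounded cube sums. *)
Lemma is_cvg_cube_sum F (G : ('I_d -> nat) -> R) (C : R) :
  (forall k, `|F k| <= G k) -> (forall N, cube_sum N G <= C) ->
  cvgn (fun N => cube_sum N F).
Proof.
move=> FG GC.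
have cvgp (H : ('I_d -> nat) -> R) (C' : R) : (forall k, 0 <= H k) ->
    (forall N, cube_sum N H <= C') -> cvgn (fun N => cube_sum N H).
  move=> H0 HC; apply: nondecreasing_is_cvgn.
    by move=> N M NM; exact: ler_cube_sum.
  by exists C' => _ [N _ <-].
have G0 k : 0 <= G k by exact: le_trans (FG k).
have -> : (fun N => cube_sum N F) = (fun N => cube_sum N (fun k => F k + G k) - cube_sum N G).
  by apply/funext => N; rewrite /cube_sum -sumrB; apply: eq_bigr => k _; rewrite addrK.
apply: is_cvgB; last exact: (cvgp _ C).
apply: (cvgp _ (C + C)) => [k|N].
  by have := FG k; rewrite ler_norml => /andP[? _]; rewrite -lerBlDr sub0r.
rewrite /cube_sum big_split/=; apply: lerD; last exact: GC.
by apply: le_trans (GC N); apply: ler_sum => k _; exact: le_trans (ler_norm _) (FG _).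
Qed.

End cube_sums.

(** * Exchange of the pointwise limit with the square integral *)

Section L2_limit.
Context {R : realType} {d : measure_display} {T : measurableType d}.
Variable mu : {measure set T -> \bar R}.

(** Fatou bounds the integral of D^2 by L and that of (D - Dn)^2 by L - S n. The triangle inequality
    sqrt (S n) <= sqrt (L - S n) + |D|_2 then gives the converse bound in the limit. *)
Lemma integral_sqr_limit (D : T -> R) (Dn : nat -> T -> R) (S : nat -> R) (L : R) :
  (forall n, measurable_fun setT (Dn n)) ->
  (forall z, Dn n z @[n --> \oo] --> D z) ->
  S n @[n --> \oo] --> L ->
  (forall n, \int[mu]_z (Dn n z ^+ 2)%:E = (S n)%:E)%E ->
  (forall n m, (n <= m)%N ->
    \int[mu]_z ((Dn m z - Dn n z) ^+ 2)%:E = (S m - S n)%:E)%E ->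
  measurable_fun setT D /\ (\int[mu]_z (D z ^+ 2)%:E = L%:E)%E.
Proof.
move=> mDn DnD SL DnS DmnS.
have mD : measurable_fun setT D.
  by apply: (measurable_fun_cvg mDn) => z _; exact: DnD.
split => //.
(* The integrals are prescribed only for large n, because those of Dm - Dn are known only for m >=
   n. *)
have fatou_le (E : T -> R) (En : nat -> T -> R) (s : nat -> R) (l : R) :
    (forall n, measurable_fun setT (En n)) ->
    (forall z, En n z @[n --> \oo] --> E z) -> s n @[n --> \oo] --> l ->
    (\forall n \near \oo, \int[mu]_z (En n z ^+ 2)%:E = (s n)%:E)%E ->
    (\int[mu]_z (E z ^+ 2)%:E <= l%:E)%E.
  move=> mE EE sl Es.
  have -> : (\int[mu]_z (E z ^+ 2)%:E = \int[mu]_z limn_einf (fun n => (En n z ^+ 2)%:E))%E.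
    apply: eq_integral => z _; apply/esym.
    have ce : ((En n z ^+ 2)%:E @[n --> \oo] --> (E z ^+ 2)%:E)%E.
      apply: cvg_EFin; first exact: nearW.
      rewrite /= /comp /= expr2; under eq_fun do rewrite /= expr2.
      by apply: cvgM; exact: EE.
    by rewrite is_cvg_limn_einfE ?(cvg_lim _ ce)//; apply/cvg_ex; eexists; exact: ce.
  apply: le_trans (@fatou _ _ _ mu setT measurableT (fun n z => (En n z ^+ 2)%:E) _ _) _.
  - by move=> n; apply/measurable_EFinP; exact: measurable_funX.
  - by move=> n z _; rewrite lee_fin sqr_ge0.
  have ci : ((\int[mu]_z (En n z ^+ 2)%:E)%E @[n --> \oo] --> l%:E)%E.
    have cs : ((s n)%:E @[n --> \oo] --> l%:E)%E by apply: cvg_EFin => //; exact: nearW.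
    apply: cvg_trans cs; apply: near_eq_cvg.
    by near=> n; apply/esym; near: n.
  by rewrite is_cvg_limn_einfE ?(cvg_lim _ ci)//; apply/cvg_ex; eexists; exact: ci.
have Dle : (\int[mu]_z (D z ^+ 2)%:E <= L%:E)%E.
  by apply: (fatou_le _ Dn S) => //; exact: nearW.
have DDle n : (\int[mu]_z ((D z - Dn n z) ^+ 2)%:E <= (L - S n)%:E)%E.
  apply: (fatou_le _ (fun m z => Dn m z - Dn n z) (fun m => S m - S n)).
  - by move=> m; exact: measurable_funB.
  - by move=> z; apply: cvgB; [exact: DnD|exact: cvg_cst].
  - by apply: cvgB => //; exact: cvg_cst.
  - by exists n => // m /= nm; exact: DmnS.
apply/eqP; rewrite eq_le Dle /=.
set I := (\int[mu]_z _)%E in Dle *.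
have I0 : (0 <= I)%E by apply: integral_ge0 => z _; rewrite lee_fin sqr_ge0.
have If : I \is a fin_num by rewrite ge0_fin_numE// (le_lt_trans Dle) ?ltry.
rewrite -(fineK If) lee_fin; set J := fine I.
have J0 : 0 <= J by exact: fine_ge0.
have S0 n : 0 <= S n.
  by rewrite -lee_fin -DnS; apply: integral_ge0 => z _; rewrite lee_fin sqr_ge0.
have LS0 n : 0 <= L - S n.
  rewrite -lee_fin; apply: le_trans (DDle n).
  by apply: integral_ge0 => z _; rewrite lee_fin sqr_ge0.
have H n : Num.sqrt (S n) <= Num.sqrt (L - S n) + Num.sqrt J.
  rewrite -lee_fin EFinD.
  have := @Lnorm2_triangle _ _ _ mu (Dn n) D (cst 0) (mDn n) mD (measurable_cst _).
  rewrite !Lnorm2E.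
  under eq_integral do rewrite /= subr0.
  rewrite DnS poweR_EFin powR12_sqrt// => /le_trans; apply.
  apply: leeD.
    rewrite -powR12_sqrt// -poweR_EFin gt0_ler_poweR ?in_itv/= ?leey ?andbT ?lee_fin//.
    - by apply: integral_ge0 => z _; rewrite lee_fin sqr_ge0.
    - by under eq_integral do rewrite -sqrrN opprB; exact: DDle.
  under eq_integral do rewrite /= subr0.
  by rewrite -/I -(fineK If) poweR_EFin powR12_sqrt.
have L0 : 0 <= L by rewrite -lee_fin (le_trans I0).
rewrite -ler_sqrt//.
have sc : continuous (@Num.sqrt R) by exact: sqrt_continuous.
have c1 : Num.sqrt (S n) @[n --> \oo] --> Num.sqrt L.
  by apply: continuous_cvg => //; exact: sc.
have c2 : Num.sqrt (L - S n) + Num.sqrt J @[n --> \oo] --> 0 + Num.sqrt J.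
  apply: cvgD; last exact: cvg_cst.
  rewrite -[X in _ --> X]sqrtr0 -(subrr L); apply: continuous_cvg; first exact: sc.
  by apply: cvgB => //; exact: cvg_cst.
rewrite -[leRHS]add0r -(cvg_lim _ c1)// -(cvg_lim _ c2)//.
apply: ler_lim; last exact: nearW.
  by apply/cvg_ex; eexists; exact: c1.
by apply/cvg_ex; eexists; exact: c2.
Unshelve. all: by end_near.
Qed.
End L2_limit.

(** * Two-sided bounds for the contribution of one mode *)

Section mode_bounds.
Context {R : realType}.
Implicit Types l c t s : R.

Lemma mode_var_sym l c t s : mode_var l c t s = mode_var l c s t.
Proof. by rewrite /mode_var (time_cov_sym l t s) (addrC (time_cov l t t)). Qed.

Lemma mode_var0 t s : mode_var 0 1 t s = `|t - s|.
Proof.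
rewrite /mode_var /time_cov eqxx !minxx mulr1.
by case: (leP t s) => ts; [rewrite ler0_norm ?subr_le0//|rewrite ger0_norm ?subr_ge0 ?ltW//]; ring.
Qed.

Lemma mode_varE l c t s : 0 < l -> s <= t ->
  let q := expR (- l * `|t - s|) in let w := expR (- l * (2 * s)) in
  mode_var l c t s = ((1 - q ^+ 2) + (1 - w) * (q ^+ 2 + 1 - 2 * c * q)) / (2 * l).
Proof.
move=> l0 st q w.
rewrite /mode_var /time_cov gt_eqF// !subrr normr0 mulr0 expR0.
have -> : expR (- l * (t + t)) = w * q ^+ 2.
  by rewrite /w /q -expRM_natl -expRD ger0_norm ?subr_ge0//; congr expR; ring.
have -> : expR (- l * (s + s)) = w by congr expR; ring.
have -> : expR (- l * (t + s)) = w * q.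
  by rewrite /w /q -expRD ger0_norm ?subr_ge0//; congr expR; ring.
by rewrite -/q; field; rewrite gt_eqF.
Qed.

Lemma expRN_itv l h : 0 <= l -> 0 <= h -> 0 < expR (- l * h) <= 1.
Proof. by move=> l0 h0; rewrite expR_gt0 -expR0 ler_expR mulNr oppr_le0 mulr_ge0. Qed.

Lemma mode_var_le l c t s : 0 < l -> -1 <= c <= 1 -> 0 <= t -> 0 <= s ->
  mode_var l c t s <= Num.min `|t - s| l^-1 + (1 - c) / l.
Proof.
wlog st : t s / s <= t.
  move=> H l0 c1 t0 s0; have [st|/ltW ts] := leP s t; first exact: H.
  by rewrite mode_var_sym distrC; exact: H.
move=> l0 /andP[c1 c2] t0 s0; rewrite mode_varE//.
set q := expR _; set w := expR _.
have /andP[q0 q1] : 0 < q <= 1 by apply: expRN_itv => //; exact: ltW.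
have /andP[w0 w1] : 0 < w <= 1 by apply: expRN_itv; rewrite ?mulr_ge0// ltW.
have qh : 1 - q <= l * `|t - s|.
  by rewrite lerBlDl -lerBlDr -mulNr; exact: expR_ge1Dx.
(* Replacing 1 - w by 1 leaves the numerator 2 (1 - c q), and (1 - q) + (1 - c) - (1 - c q) = (1 -
   q) (1 - c) >= 0. *)
apply: (@le_trans _ _ ((1 - q) / l + (1 - c) / l)).
  rewrite -mulrDl ler_pdivrMr ?mulr_gt0//.
  have -> : (1 - q + (1 - c)) / l * (2 * l) = 2 * (1 - q + (1 - c)) by field; rewrite gt_eqF.
  have p0 : 0 <= q ^+ 2 + 1 - 2 * c * q by nra.
  have h1 : (1 - w) * (q ^+ 2 + 1 - 2 * c * q) <= q ^+ 2 + 1 - 2 * c * q by nra.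
  apply: le_trans (_ : 1 - q ^+ 2 + (q ^+ 2 + 1 - 2 * c * q) <= _); first by rewrite lerD2l.
  nra.
rewrite lerD2r le_min ler_pdivrMr// mulrC qh/=.
by rewrite ler_pdivrMr// mulVf ?gt_eqF//; lra.
Qed.

Lemma mode_var_ge_time l c t s : 0 < l -> -1 <= c <= 1 -> 0 <= t -> 0 <= s ->
  `|t - s| / (1 + 2 * l * `|t - s|) <= mode_var l c t s.
Proof.
wlog st : t s / s <= t.
  move=> H l0 c1 t0 s0; have [st|/ltW ts] := leP s t; first exact: H.
  by rewrite mode_var_sym distrC; exact: H.
move=> l0 /andP[c1 c2] t0 s0; rewrite mode_varE//.
set q := expR _; set w := expR _; set h := `|t - s|.
have h0 : 0 <= h by exact: normr_ge0.
have /andP[q0 q1] : 0 < q <= 1 by apply: expRN_itv => //; exact: ltW.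
have /andP[w0 w1] : 0 < w <= 1 by apply: expRN_itv; rewrite ?mulr_ge0// ltW.
have lh0 : 0 <= l * h by rewrite mulr_ge0// ltW.
have d0 : 0 < 1 + 2 * l * h by rewrite -mulrA; lra.
(* Since q^2 = e^(-2 l h), this is e^a >= 1 + a. The spatial part of the numerator is nonnegative
   and is dropped. *)
have q2 : q ^+ 2 <= (1 + 2 * l * h)^-1.
  rewrite /q -expRM_natl -[leLHS]invrK lef_pV2 ?posrE ?invr_gt0 ?expR_gt0//.
  rewrite -expRN; apply: le_trans (expR_ge1Dx _).
  by rewrite le_eqVlt; apply/orP; left; apply/eqP; rewrite /h; ring.
rewrite ler_pdivlMr ?mulr_gt0//.
have -> : h / (1 + 2 * l * h) * (2 * l) = 1 - (1 + 2 * l * h)^-1 by field; rewrite gt_eqF.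
have : 0 <= (1 - w) * (q ^+ 2 + 1 - 2 * c * q) by apply: mulr_ge0; nra.
lra.
Qed.

(** The condition 1 <= l, true of every nonzero frequency, bounds [w] by e^(-2 t0) uniformly.
    Multiplying all of the numerator by 1 - w leaves 2 (1 - w) (1 - c q), and 2 (1 - c q) >= 1 - c
    for either sign of [c]. *)
Lemma mode_var_ge_space l c t s t0 : 1 <= l -> -1 <= c <= 1 -> 0 <= t0 ->
  t0 <= t -> t0 <= s ->
  (1 - expR (- (2 * t0))) * (1 - c) / (2 * l) <= mode_var l c t s.
Proof.
wlog st : t s / s <= t.
  move=> H l1 c1 t00 tt0 st0; have [st|/ltW ts] := leP s t; first exact: H.
  by rewrite mode_var_sym; exact: H.
move=> l1 /andP[c1 c2] t00 tt0 st0.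
have l0 : 0 < l by exact: lt_le_trans l1.
rewrite mode_varE//.
set q := expR (- l * _); set w := expR (- l * _).
have /andP[q0 q1] : 0 < q <= 1 by apply: expRN_itv => //; exact: ltW.
have /andP[w0 w1] : 0 < w <= 1.
  by apply: expRN_itv; rewrite ?mulr_ge0//; [exact: ltW|exact: le_trans st0].
have ww : w <= expR (- (2 * t0)).
  rewrite ler_expR mulNr lerN2 mulrCA ler_pM2l//.
  by apply: (le_trans st0); rewrite ler_peMl// (le_trans t00).
rewrite ler_pM2r ?invr_gt0 ?mulr_gt0//.
have h1 : 0 <= q ^+ 2 + 1 - 2 * c * q by nra.
have h2 : (1 - expR (- (2 * t0))) * (1 - c) <= (1 - w) * (1 - c).
  by rewrite ler_wpM2r ?subr_ge0// lerD2l lerN2.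
apply: (le_trans h2).
have q2 : q ^+ 2 <= 1 by nra.
have h3 : (1 - w) * (1 - q ^+ 2) <= 1 - q ^+ 2 by nra.
have h4 : (1 - w) * (1 - c) <= (1 - w) * (1 - q ^+ 2 + (q ^+ 2 + 1 - 2 * c * q)).
  by apply: ler_wpM2l; nra.
nra.
Qed.

End mode_bounds.

(** * Quadratic bounds for one minus a cosine or a product of cosines *)

Section cosine_bounds.
Context {R : realType}.
Implicit Types a x : R.

Lemma sin_mvt a : exists2 x, `|x| <= `|a| & sin a = cos x * a.
Proof.
wlog a0 : a / 0 <= a.
  move=> H; have [|/ltW a0] := leP 0 a; first exact: H.
  have [|x xa E] := H (- a); first by rewrite oppr_ge0.
  by exists x; rewrite ?normrN in xa *; [|apply/oppr_inj; rewrite -sinN E mulrN].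
have [x] := @MVT_segment R sin cos 0 a a0 (fun x _ => is_derive_sin x)
  (continuous_subspaceT (@continuous_sin R)).
rewrite in_itv/= => /andP[x0 xa]; rewrite sin0 !subr0 => E.
by exists x; rewrite ?ger0_norm.
Qed.

Lemma oneBcosE a : 1 - cos a = 2 * sin (a / 2) ^+ 2.
Proof.
have E : a = (a / 2) *+ 2 by rewrite mulr2n -splitr.
by rewrite {1}E cos_mulr2n sin2cos2 mulr2n; ring.
Qed.

Lemma oneBcos_le_sqr a : 1 - cos a <= a ^+ 2 / 2.
Proof.
rewrite oneBcosE; have [x _ ->] := sin_mvt (a / 2).
have := cos2Dsin2 x; have := sqr_ge0 (sin x); have := sqr_ge0 (a); nra.
Qed.

(** Two halvings give 1 - cos a = 8 sin^2 (a/4) cos^2 (a/4), and sin (a/4) = cos x * a/4 with |x| <=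
    pi/4. On that range cos^2 >= 1/2, which is used twice. *)
Lemma oneBcos_ge_sqr a : `|a| <= pi -> a ^+ 2 / 8 <= 1 - cos a.
Proof.
move=> api.
have half y : `|y| <= pi / 4 -> 2^-1 <= cos y ^+ 2 :> R.
  move=> ypi; have : 0 <= cos (y *+ 2).
    apply: cos_ge0_pihalf; move: ypi; rewrite ler_norml [y *+ 2]mulr2n => /andP[y1 y2].
    by apply/andP; split; lra.
  by rewrite cos_mulr2n [_ *+ 2]mulr2n; lra.
have a4 : `|a / 4| <= pi / 4 by rewrite normrM [`|4^-1|]ger0_norm// ler_pM2r.
have [x xa E] := sin_mvt (a / 4).
have hx := half x (le_trans xa a4); have h4 := half _ a4.
rewrite oneBcosE (_ : a / 2 = (a / 4) *+ 2); last by rewrite [RHS]mulr2n; lra.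
rewrite sin_mulr2n mulr2n E.
have -> : 2 * (cos (a / 4) * (cos x * (a / 4)) + cos (a / 4) * (cos x * (a / 4))) ^+ 2 =
  a ^+ 2 / 2 * (cos (a / 4) ^+ 2 * cos x ^+ 2) by field.
have -> : a ^+ 2 / 8 = a ^+ 2 / 2 * (2^-1 * 2^-1) by field.
rewrite ler_wpM2l ?divr_ge0 ?sqr_ge0//; nra.
Qed.

(** Induction on 1 - f p = (1 - f) + f (1 - p), where f <= 1 and 1 - p >= 0. *)
Lemma oneBprod_le (I : Type) (r : seq I) (f : I -> R) :
  (forall i, -1 <= f i <= 1) ->
  1 - \prod_(i <- r) f i <= \sum_(i <- r) (1 - f i).
Proof.
move=> f1; elim: r => [|i r IH]; first by rewrite !big_nil subrr.
rewrite !big_cons.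
have : `|\prod_(j <- r) f j| <= 1.
  by rewrite normr_prod; apply: prodr_ile1 => j _; rewrite normr_ge0 ler_norml f1.
rewrite ler_norml => /andP[p1 p2]; have /andP[f1i f2i] := f1 i.
nra.
Qed.

Lemma norm_prod_le1 (I : finType) (f : I -> R) (P : pred I) :
  (forall i, `|f i| <= 1) -> `|\prod_(i | P i) f i| <= 1.
Proof.
by move=> f1; rewrite normr_prod; apply: prodr_ile1 => j _; rewrite normr_ge0 f1.
Qed.

(** The other factors multiply to at most 1, so with f j >= 0 they cannot lift the product above f
    j; two negative factors could. *)
Lemma oneBprod_ge (I : finType) (f : I -> R) (j : I) :
  (forall i, `|f i| <= 1) -> 0 <= f j -> 1 - f j <= 1 - \prod_i f i.
Proof.
move=> f1 fj; rewrite lerD2l lerN2 (bigD1 j)//=.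
have := norm_prod_le1 (fun i => i != j) f1; rewrite ler_norml => /andP[_ p].
by rewrite -[leRHS]mulr1 ler_wpM2l.
Qed.

End cosine_bounds.

(** * One-dimensional sums with a cutoff *)

Section one_dimensional_sums.
Context {R : realType}.
Implicit Types M : R.

(* The summand is at most [4 M^2 / ((M + m) (M + m + 1))], which telescopes. *)
Lemma sum_min_sqr_le M (N : nat) : 0 < M ->
  \sum_(m < N) Num.min 1 ((M / m.+1%:R) ^+ 2) <= 4 * M.
Proof.
move=> M0.
suff H : \sum_(m < N) Num.min 1 ((M / m.+1%:R) ^+ 2) <= 4 * M ^+ 2 * (M^-1 - (M + N%:R)^-1).
  apply: (le_trans H); have -> : 4 * M = 4 * M ^+ 2 * M^-1 by field; rewrite gt_eqF.
  apply: ler_wpM2l; first by rewrite mulr_ge0 ?sqr_ge0.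
  by rewrite gerBl invr_ge0 addr_ge0// ltW.
elim: N => [|N IH]; first by rewrite big_ord0 addr0 subrr mulr0.
rewrite big_ord_recr/=.
set n : R := N%:R; have n0 : 0 <= n by rewrite /n.
have nE : N.+1%:R = n + 1 :> R by rewrite /n -natr1.
rewrite nE; rewrite -/n in IH.
have a0 : 0 < M + n by lra.
have b0 : 0 < M + n + 1 by lra.
have step : Num.min 1 ((M / (n + 1)) ^+ 2) <= 4 * M ^+ 2 * ((M + n)^-1 - (M + (n + 1))^-1).
  have -> : (M + n)^-1 - (M + (n + 1))^-1 = ((M + n) * (M + n + 1))^-1.
    by field; do ?(apply/andP; split); rewrite gt_eqF//; lra.
  rewrite ler_pdivlMr ?mulr_gt0//.
  have [Mn|nM] := leP M (n + 1).
    apply: (@le_trans _ _ ((M / (n + 1)) ^+ 2 * ((M + n) * (M + n + 1)))).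
      by rewrite ler_wpM2r ?ge_min ?lexx ?orbT// mulr_ge0// ltW.
    rewrite exprMn exprVn mulrAC.
    rewrite ler_pdivrMr ?exprn_gt0//; last by lra.
    have M2 : 0 <= M ^+ 2 by exact: sqr_ge0.
    rewrite [4 * _]mulrC -[leRHS]mulrA ler_wpM2l//; nra.
  apply: (@le_trans _ _ (1 * ((M + n) * (M + n + 1)))).
    by rewrite ler_wpM2r ?ge_min ?lexx// mulr_ge0// ltW.
  nra.
by apply: (le_trans (lerD IH step)); rewrite -mulrDr subrKA.
Qed.

Lemma ln_ge_1Binv (x : R) : 0 < x -> 1 - x^-1 <= ln x.
Proof.
move=> x0; have := @le_ln1Dx R (x^-1 - 1).
rewrite subrKC lnV ?posrE// => H; suff : - ln x <= x^-1 - 1 by lra.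
by apply: H; rewrite ltrBrDl subrr invr_gt0.
Qed.

(** The term at n + 1 is at most 2 M / ((n + 1) (n + 1 + M)), hence at most twice the decrease of ln
    ((n + M) / n) from n to n + 1. The sum telescopes; the first term gives the constant 1. *)
Lemma sum_harmonic_min_sqr_le M (N : nat) : 0 < M ->
  \sum_(m < N) m.+1%:R^-1 * Num.min 1 ((M / m.+1%:R) ^+ 2) <= 1 + 2 * ln (1 + M).
Proof.
move=> M0.
have ln1 : 0 <= ln (1 + M) by apply: ln_ge0; lra.
case: N => [|N]; first by rewrite big_ord0; lra.
suff H : \sum_(m < N.+1) m.+1%:R^-1 * Num.min 1 ((M / m.+1%:R) ^+ 2) <=
    1 + 2 * (ln (1 + M) - ln ((N.+1%:R + M) / N.+1%:R)).
  have : 0 <= ln ((N.+1%:R + M) / N.+1%:R) by apply: ln_ge0; rewrite ler_pdivlMr ?ltr0Sn//; lra.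
  by move=> h; apply: (le_trans H); lra.
elim: N => [|N IH].
  rewrite big_ord1 /= !divr1 invr1 mul1r subrr mulr0 addr0.
  by rewrite ge_min lexx.
rewrite big_ord_recr/=.
set n : R := N.+1%:R in IH *; have n0 : 1 <= n by rewrite /n ler1n.
have nE : N.+2%:R = n + 1 :> R by rewrite /n -natr1.
rewrite nE.
have step : (n + 1)^-1 * Num.min 1 ((M / (n + 1)) ^+ 2) <= 2 * (M / ((n + 1) * (n + 1 + M))).
  rewrite [leRHS](_ : _ = (n + 1)^-1 * (2 * M / (n + 1 + M))); last first.
    by field; apply/andP; split; rewrite gt_eqF//; lra.
  rewrite ler_wpM2l ?invr_ge0//; first by lra.
  rewrite ler_pdivlMr; last by lra.
  have [Mn|nM] := leP M (n + 1).
    apply: (@le_trans _ _ ((M / (n + 1)) ^+ 2 * (n + 1 + M))).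
      by rewrite ler_wpM2r ?ge_min ?lexx ?orbT//; lra.
    rewrite exprMn exprVn mulrAC ler_pdivrMr ?exprn_gt0//; last by lra.
    have H : M * (n + 1 + M) <= 2 * (n + 1) ^+ 2 by nra.
    rewrite expr2 -mulrA [2 * M]mulrC -[leRHS]mulrA ler_wpM2l//; exact: ltW.
  apply: (@le_trans _ _ (1 * (n + 1 + M))).
    by rewrite ler_wpM2r ?ge_min ?lexx//; lra.
  lra.
have step2 : M / ((n + 1) * (n + 1 + M)) <= ln ((n + M) / n) - ln ((n + 1 + M) / (n + 1)).
  rewrite -ln_div ?posrE ?divr_gt0//; try lra.
  apply: le_trans (ln_ge_1Binv _); last by rewrite !divr_gt0//; lra.
  rewrite [leRHS](_ : _ = M / ((n + 1) * (n + M))); last first.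
    by field; do !(apply/andP; split); rewrite gt_eqF//; lra.
  rewrite ler_pM2l// lef_pV2 ?posrE ?mulr_gt0//; lra.
lra.
Qed.

Lemma ln_le_harmonic (N : nat) : ln (N.+1%:R : R) <= \sum_(m < N) m.+1%:R^-1.
Proof.
elim: N => [|N IH]; first by rewrite ln1 big_ord0.
rewrite big_ord_recr/=.
have -> : N.+2%:R = N.+1%:R * (1 + N.+1%:R^-1) :> R.
  by rewrite mulrDr mulr1 mulfV ?pnatr_eq0// natr1.
rewrite lnM ?posrE ?ltr0Sn ?addr_gt0 ?invr_gt0 ?ltr0Sn//.
apply: lerD => //; apply: le_ln1Dx.
by rewrite (@lt_trans _ _ 0) ?invr_gt0 ?ltr0Sn//; lra.
Qed.
End one_dimensional_sums.

(** * Torus distance, eigenvalues and weights *)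

Section torus_geometry.
Context {R : realType}.

Lemma centered_rep_norm (a : R) : `|centered_rep a| <= pi.
Proof.
have p0 : 0 < 2 * pi :> R by rewrite mulr_gt0// pi_gt0.
rewrite /centered_rep; set n := Num.floor _.
have /andP[] := floor_itv ((a + pi) / (2 * pi)).
rewrite -/n ler_pdivlMr// ltr_pdivrMr// intrD mulrDl mul1r => n1 n2.
by rewrite ler_norml; apply/andP; split; lra.
Qed.

Lemma cosD2piMz (x : R) (n : int) : cos (x + n%:~R * (2 * pi)) = cos x.
Proof.
case: n => n; first exact: cosD2piMn.
by rewrite -(cosD2piMn (x + _) n.+1) NegzE mulrNz mulNr addrNK.
Qed.

Lemma cos_centered_rep (k : nat) (a : R) : cos (k%:R * centered_rep a) = cos (k%:R * a).
Proof.
rewrite /centered_rep; set n := Num.floor _.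
rewrite -[RHS](cosD2piMz _ (- (k%:Z * n))); congr cos.
by rewrite intrN intrM; ring.
Qed.

Variable d : nat.
Implicit Types x y : d.-tuple R.

Definition torus_diff x y (j : 'I_d) : R := centered_rep (tnth x j - tnth y j).

Lemma torus_distE x y : torus_dist x y ^+ 2 = \sum_(j < d) torus_diff x y j ^+ 2.
Proof. by rewrite sqr_sqrtr// sumr_ge0// => j _; rewrite sqr_ge0. Qed.

Lemma torus_dist_ge0 x y : 0 <= torus_dist x y.
Proof. exact: sqrtr_ge0. Qed.

Lemma torus_dist_le x y : (d <= 3)%N -> torus_dist x y <= 2 * pi.
Proof.
move=> d3; have pi0 := pi_ge0 R.
rewrite -ler_sqr ?nnegrE ?torus_dist_ge0 ?mulr_ge0// torus_distE.
apply: (@le_trans _ _ (\sum_(j < d) pi ^+ 2)).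
  apply: ler_sum => j _; rewrite -real_normK ?num_real//.
  by rewrite ler_sqr ?nnegrE// centered_rep_norm.
rewrite sumr_const card_ord -[leLHS]mulr_natl exprMn ler_wpM2r ?sqr_ge0//.
by rewrite -natrX ler_nat (leq_trans d3).
Qed.

Lemma torus_diff_le x y j : `|torus_diff x y j| <= torus_dist x y.
Proof.
rewrite -ler_sqr ?nnegrE ?torus_dist_ge0// torus_distE real_normK ?num_real//.
by rewrite (bigD1 j)//= lerDl sumr_ge0// => i _; rewrite sqr_ge0.
Qed.

Lemma mode_cosE (k : 'I_d -> nat) x y :
  mode_cos k x y = \prod_(j < d) cos ((k j)%:R * torus_diff x y j).
Proof. by apply: eq_bigr => j _; rewrite cos_centered_rep. Qed.

Lemma mode_cos_itv (k : 'I_d -> nat) x y : -1 <= mode_cos k x y <= 1.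
Proof. by rewrite -ler_norml; exact: norm_cos_prod_le1. Qed.

Lemma oneBmode_cos_le (k : 'I_d -> nat) x y (m : nat) : (forall i, (k i <= m)%N) ->
  1 - mode_cos k x y <= 2 * Num.min 1 ((m%:R * torus_dist x y) ^+ 2).
Proof.
move=> km; have /andP[c1 c2] := mode_cos_itv k x y.
have H : 1 - mode_cos k x y <= (m%:R * torus_dist x y) ^+ 2 / 2.
  rewrite mode_cosE; apply: le_trans (oneBprod_le _ _) _.
    by move=> i; rewrite cos_geN1 cos_le1.
  rewrite exprMn torus_distE mulr_sumr mulr_suml; apply: ler_sum => j _.
  apply: le_trans (oneBcos_le_sqr _) _.
  rewrite exprMn ler_pM2r ?invr_gt0// ler_wpM2r ?sqr_ge0//.
  by rewrite ler_sqr ?nnegrE// ler_nat.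
have := sqr_ge0 (m%:R * torus_dist x y).
by case: (leP 1 ((m%:R * torus_dist x y) ^+ 2)); lra.
Qed.

Lemma ler_lambda (k : 'I_d -> nat) (j : 'I_d) : (k j)%:R ^+ 4 <= lambda k :> R.
Proof. by rewrite /lambda (bigD1 j)//= lerDl sumr_ge0// => i _; rewrite exprn_ge0. Qed.

Lemma lambda_le (k : 'I_d -> nat) (m : nat) : (forall i, (k i <= m)%N) ->
  lambda k <= d%:R * m%:R ^+ 4 :> R.
Proof.
move=> km; apply: (@le_trans _ _ (\sum_(j < d) m%:R ^+ 4)).
  by apply: ler_sum => i _; rewrite lerXn2r ?nnegrE// ler_nat.
by rewrite sumr_const card_ord mulr_natl.
Qed.

Lemma mode_weight_le1 (k : 'I_d -> nat) : mode_weight k <= 1 :> R.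
Proof.
rewrite invf_le1 ?mulr_gt0 ?exprn_gt0 ?pi_gt0// mulr_ege1// exprn_ege1//.
  by rewrite ler1n.
by have := pi_ge2 R; lra.
Qed.

Lemma mode_weight_ge (k : 'I_d -> nat) : ((2 * pi) ^+ d)^-1 <= mode_weight k :> R.
Proof.
rewrite lef_pV2 ?posrE ?mulr_gt0 ?exprn_gt0 ?mulr_gt0 ?pi_gt0//.
rewrite exprMn ler_wpM2r ?exprn_ge0 ?pi_ge0// ler_weXn2l ?ler1n//.
by rewrite /null_components; apply: leq_trans (max_card _) _; rewrite card_ord.
Qed.

(** Extends the time bound to the null eigenvalue, where the variance is |t - s| + 2 min (t, s) (1 -
    c). *)
Lemma mode_var_lambda_ge (k : 'I_d -> nat) (t s : R) x y : 0 <= t -> 0 <= s ->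
  `|t - s| / (1 + 2 * lambda k * `|t - s|) <= mode_var (lambda k) (mode_cos k x y) t s.
Proof.
move=> t0 s0; have := lambda_ge0 (R := R) k; rewrite le_eqVlt => /predU1P[<-|l0].
  rewrite mulr0 mul0r addr0 divr1 /mode_var /time_cov eqxx !minxx.
  have /andP[_ c1] := mode_cos_itv k x y.
  have c10 : 0 <= 1 - mode_cos k x y by rewrite subr_ge0.
  have := mulr_ge0 t0 c10; have := mulr_ge0 s0 c10.
  case: (leP t s) => ts h1 h2.
    by rewrite ler0_norm ?subr_le0//; nra.
  by rewrite ger0_norm ?subr_ge0 ?(ltW ts)//; nra.
by apply: mode_var_ge_time => //; exact: mode_cos_itv.
Qed.

Lemma mode_dist_ge0 (t s : R) x y (k : 'I_d -> nat) : 0 <= t -> 0 <= s ->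
  0 <= mode_dist t s x y k.
Proof.
move=> t0 s0; rewrite /mode_dist mulr_ge0 ?(ltW (mode_weight_gt0 k))//.
apply: le_trans (mode_var_lambda_ge _ _ _ t0 s0).
by rewrite divr_ge0// addr_ge0// mulr_ge0// mulr_ge0// lambda_ge0.
Qed.

End torus_geometry.

(** * Upper bounds for the lattice sums *)

Section lattice_upper_bound.
Context {R : realType}.
Variable d : nat.
Hypothesis hd : (1 <= d <= 3)%N.

(** The null frequency is split off and the index shifted: m + 2 <= 2 (m + 1), and 2^(d - 1) <= 4
    for d <= 3. *)
Lemma shell_sum_le (B : nat -> R) (N : nat) : (forall m, 0 <= B m) ->
  \sum_(m < N) (m.+1 ^ d.-1)%:R * B m <=
  B 0%N + 4 * \sum_(m < N) m.+1%:R ^+ d.-1 * B m.+1.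
Proof.
move=> B0; case: N => [|N]; first by rewrite !big_ord0 mulr0 addr0.
rewrite big_ord_recl exp1n mul1r lerD2l//=.
apply: (@le_trans _ _ (\sum_(m < N) 4 * (m.+1%:R ^+ d.-1 * B m.+1))).
  apply: ler_sum => m _; rewrite mulrA ler_wpM2r//.
  rewrite -!natrX -natrM ler_nat.
  apply: (@leq_trans ((2 * m.+1) ^ d.-1)%N).
    have mm : ((bump 0 m).+1 <= 2 * m.+1)%N.
      by rewrite /bump leq0n add1n mul2n -addnn addSn addnS !ltnS leq_addr.
    by case: d.-1 => // e; rewrite leq_exp2r.
  rewrite expnMn leq_mul2r; apply/orP; right.
  by move: hd; case: d => [|[|[|[|]]]].
rewrite -mulr_sumr ler_wpM2l// big_ord_recr/= lerDl.
by rewrite mulr_ge0.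
Qed.

(** M = h^(-1/4) is the crossover where h = M^(-4). Since d - 1 <= 2, each term is at most M^(d - 5)
    min (1, (M/n)^2); summing gives 4 M^(d - 4). *)
Lemma time_shell_sum_le (h : R) (N : nat) : 0 < h ->
  \sum_(m < N) m.+1%:R ^+ d.-1 * Num.min h (m.+1%:R ^+ 4)^-1 <= 4 * h `^ (1 - d%:R / 4).
Proof.
move=> h0; pose M := h `^ (- 4^-1).
have M0 : 0 < M by exact: powR_gt0.
have M4 : M ^+ 4 = h^-1.
  by rewrite -powR_mulrn ?powR_ge0// -powRrM mulNr mulVf// powR_inv1// ltW.
have hM : h `^ (1 - d%:R / 4) = M ^+ d.-1 / M ^+ 4 * M.
  rewrite M4 invrK mulrAC -exprSr prednK; last by case/andP: hd.
  rewrite -powR_mulrn ?powR_ge0// -powRrM -[X in _ = _ * X](powRr1 (ltW h0)).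
  by rewrite -powRD ?(gt_eqF h0) ?implybT//; congr (_ `^ _); field.
have hE : h = (M ^+ 4)^-1 by rewrite M4 invrK.
rewrite hM mulrCA -mulrA.
apply: (@le_trans _ _ (\sum_(m < N) (M ^+ d.-1 / M ^+ 4) * Num.min 1 ((M / m.+1%:R) ^+ 2))).
  apply: ler_sum => m _; set n : R := m.+1%:R.
  have n0 : 0 < n by rewrite /n ltr0Sn.
  have MM : 0 < M ^+ 4 by rewrite exprn_gt0.
  have n4 : 0 < n ^+ 4 by rewrite exprn_gt0.
  have [nM|Mn] := leP n M.
    have -> : Num.min 1 ((M / n) ^+ 2) = 1.
      by rewrite min_l// exprn_ege1// ler_pdivlMr// mul1r.
    rewrite mulr1; apply: ler_pM; rewrite ?exprn_ge0 ?le_min ?invr_ge0 ?(ltW n4) ?(ltW h0) ?(ltW n0)//.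
      by rewrite lerXn2r ?nnegrE// ltW.
    by rewrite ge_min hE lexx.
  apply: (@le_trans _ _ (n ^+ d.-1 / n ^+ 4)).
    by rewrite ler_wpM2l ?exprn_ge0 ?ge_min ?lexx ?orbT// ltW.
  have -> : Num.min 1 ((M / n) ^+ 2) = (M / n) ^+ 2.
    have Mn1 : M / n <= 1 by rewrite ler_pdivrMr// mul1r ltW.
    by rewrite min_r// exprn_ile1// divr_ge0// ltW.
  have H : n ^+ d.-1 * M ^+ 2 <= M ^+ d.-1 * n ^+ 2.
    move: hd; case: d => [|[|[|[|]]]]//= _; rewrite ?expr0 ?expr1 ?mul1r//.
    - by rewrite lerXn2r ?nnegrE ?ltW.
    - have : 0 <= n * M * (n - M) by rewrite !mulr_ge0 ?subr_ge0 // ltW.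
      by rewrite !expr2; lra.
    - by rewrite mulrC.
  have -> : n ^+ d.-1 / n ^+ 4 = (n ^+ d.-1 * M ^+ 2) / (n ^+ 4 * M ^+ 2).
    by field; rewrite !gt_eqF.
  have -> : M ^+ d.-1 / M ^+ 4 * (M / n) ^+ 2 = (M ^+ d.-1 * n ^+ 2) / (n ^+ 4 * M ^+ 2).
    by field; rewrite !gt_eqF.
  by rewrite ler_wpM2r// invr_ge0 mulr_ge0 ?exprn_ge0 ?ltW.
rewrite -mulr_sumr mulrA ler_wpM2l ?divr_ge0 ?exprn_ge0 ?(ltW M0)//.
exact: sum_min_sqr_le.
Qed.

(* For d <= 3 distances on the torus are at most 2 pi, so that
   [ln (log_const / z) >= 1]. *)
Definition log_const : R := expR 1 * (2 * pi).

Lemma log_const_gt0 : 0 < log_const.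
Proof. by rewrite mulr_gt0 ?expR_gt0 ?mulr_gt0 ?pi_gt0. Qed.

Lemma ln_log_const_ge1 (z : R) : 0 < z <= 2 * pi -> 1 <= ln (log_const / z).
Proof.
move=> /andP[z0 zp]; rewrite -[leLHS](expRK 1) ler_ln ?posrE ?divr_gt0 ?log_const_gt0 ?expR_gt0//.
by rewrite ler_pdivlMr// ler_wpM2l// expR_ge0.
Qed.

Definition space_modulus (z : R) : R :=
  ln (log_const / z) ^+ (d == 2%N) * z ^+ minn 2 (4 - d).

Lemma space_modulus0 : space_modulus 0 = 0.
Proof.
rewrite /space_modulus; move: hd; case: d => [|[|[|[|]]]]//= _;
  by rewrite expr0n mulr0.
Qed.

Lemma space_modulus_ge0 z : 0 <= z <= 2 * pi -> 0 <= space_modulus z.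
Proof.
move=> /andP[]; rewrite le_eqVlt => /predU1P[<- _|z0 zp]; first by rewrite space_modulus0.
rewrite /space_modulus mulr_ge0 ?exprn_ge0 ?(ltW z0)//.
by rewrite (le_trans ler01)// ln_log_const_ge1// z0.
Qed.

(** Writing min (1, (n z)^2) as (n z)^2 min (1, (1/(n z))^2) leaves z^2 n^(d - 3) times a cutoff at
    1/z. For d = 1 the series of n^(-2) suffices; d = 2 is the harmonic sum with cutoff; for d = 3
    the cutoff sum is at most 4/z. *)
Lemma space_shell_sum_le (z : R) (N : nat) : 0 <= z <= 2 * pi ->
  \sum_(m < N) m.+1%:R ^+ d.-1 * (Num.min 1 ((m.+1%:R * z) ^+ 2) / m.+1%:R ^+ 4) <=
  4 * space_modulus z.
Proof.
move=> /andP[]; rewrite le_eqVlt => /predU1P[<- _|z0 zp].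
  rewrite space_modulus0 mulr0 big1// => m _.
  by rewrite mulr0 expr0n/= min_r ?ler01// mul0r mulr0.
have minE (n : R) : 0 < n ->
    Num.min 1 ((n * z) ^+ 2) = n ^+ 2 * z ^+ 2 * Num.min 1 ((z^-1 / n) ^+ 2).
  move=> n0.
  have nz : 0 < n ^+ 2 * z ^+ 2 by rewrite mulr_gt0 ?exprn_gt0.
  rewrite minr_pMr ?(ltW nz)// mulr1 minC exprMn; congr (Num.min _ _).
  by field; rewrite !gt_eqF.
have zi : 0 < z^-1 by rewrite invr_gt0.
have lz := ln_log_const_ge1 (introT andP (conj z0 zp)).
rewrite /space_modulus; case/andP: hd; case: d => [|[|[|[|]]]]//= _ _.
- rewrite mul1r; apply: (@le_trans _ _ (\sum_(m < N) z ^+ 2 * Num.min 1 ((1 / m.+1%:R) ^+ 2))).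
    apply: ler_sum => m _; set n : R := m.+1%:R; have n0 : 0 < n by rewrite /n ltr0Sn.
    have -> : Num.min 1 ((1 / n) ^+ 2) = n ^- 2.
      by rewrite mul1r exprVn min_r// invf_le1 ?exprn_gt0// exprn_ege1// /n ler1n.
    rewrite mul1r ler_pdivrMr ?exprn_gt0// ge_min; apply/orP; right.
    by rewrite le_eqVlt; apply/orP; left; apply/eqP; field; rewrite gt_eqF.
  by rewrite -mulr_sumr mulrC ler_wpM2r ?sqr_ge0// -[4]mulr1 sum_min_sqr_le.
- apply: (@le_trans _ _ (z ^+ 2 * (1 + 2 * ln (1 + z^-1)))).
    apply: le_trans (ler_wpM2l (sqr_ge0 z) (sum_harmonic_min_sqr_le N zi)).
    rewrite mulr_sumr; apply: ler_sum => m _.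
    set n : R := m.+1%:R; have n0 : 0 < n by rewrite /n ltr0Sn.
    rewrite minE// le_eqVlt; apply/orP; left; apply/eqP; rewrite expr1.
    by field; rewrite !gt_eqF.
  rewrite expr1 mulrC mulrA ler_wpM2r ?sqr_ge0//.
  (* Amounts to z + 1 <= 2 pi e. As the right side is at least 1, it also absorbs the additive
     constant. *)
  have : ln (1 + z^-1) <= ln (log_const / z).
    rewrite ler_ln ?posrE ?divr_gt0 ?log_const_gt0 ?addr_gt0//.
    rewrite ler_pdivlMr// mulrDl mul1r mulVf ?gt_eqF//.
    have := pi_ge2 R; have := expR_ge1Dx (1 : R); rewrite /log_const; nra.
  lra.
- apply: (@le_trans _ _ (\sum_(m < N) z ^+ 2 * Num.min 1 ((z^-1 / m.+1%:R) ^+ 2))).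
    apply: ler_sum => m _; set n : R := m.+1%:R; have n0 : 0 < n by rewrite /n ltr0Sn.
    rewrite minE// le_eqVlt; apply/orP; left; apply/eqP.
    by field; rewrite gt_eqF.
  rewrite -mulr_sumr mul1r expr1.
  apply: le_trans (ler_wpM2l (sqr_ge0 z) (sum_min_sqr_le N zi)) _.
  by rewrite le_eqVlt; apply/orP; left; apply/eqP; field; rewrite gt_eqF.
Qed.

Lemma mode_dist_shell_le (t s : R) (x y : d.-tuple R) (k : 'I_d -> nat) j :
  0 <= t -> 0 <= s -> (forall i, (k i <= k j)%N) ->
  mode_dist t s x y k <=
  if k j is n.+1 then Num.min `|t - s| (n.+1%:R ^+ 4)^-1 +
      2 * (Num.min 1 ((n.+1%:R * torus_dist x y) ^+ 2) / n.+1%:R ^+ 4)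
  else `|t - s|.
Proof.
move=> t0 s0 kj.
have mv0 := mode_dist_ge0 x y k t0 s0.
rewrite /mode_dist in mv0 *.
have w0 := mode_weight_gt0 (R := R) k.
rewrite pmulr_rge0// in mv0.
apply: (@le_trans _ _ (mode_var (lambda k) (mode_cos k x y) t s)).
  by rewrite ler_piMl// mode_weight_le1.
have cc := mode_cos_itv k x y; have lj := ler_lambda (R := R) k j.
have c1 := oneBmode_cos_le x y kj.
move: lj c1; case E : (k j) => [|n] lj c1.
  have -> : lambda k = 0 :> R.
    apply/eqP; rewrite eq_le lambda_ge0 andbT.
    apply: (le_trans (@lambda_le R d k 0 _)); first by move=> i; rewrite -E.
    by rewrite expr0n mulr0.
  have -> : mode_cos k x y = 1.
    rewrite /mode_cos big1// => i _.
    by have := kj i; rewrite E leqn0 => /eqP ->; rewrite mul0r cos0.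
  by rewrite mode_var0.
have n4 : 0 < n.+1%:R ^+ 4 :> R by rewrite exprn_gt0.
have l0 : 0 < lambda k :> R by exact: lt_le_trans lj.
apply: (le_trans (mode_var_le l0 cc t0 s0)); apply: lerD.
  by rewrite le_min !ge_min lexx/= lef_pV2 ?posrE// lj orbT.
rewrite mulrA; apply: ler_pM => //.
- by case/andP: cc; rewrite subr_ge0.
- by rewrite invr_ge0 ltW.
- by rewrite lef_pV2 ?posrE.
Qed.

Lemma cube_sum_mode_dist_le (T t s : R) (x y : d.-tuple R) (N : nat) :
  0 <= t <= T -> 0 <= s <= T ->
  cube_sum N (mode_dist t s x y) <=
  d%:R * (T `^ (d%:R / 4) + 32) * (`|t - s| `^ (1 - d%:R / 4) + space_modulus (torus_dist x y)).
Proof.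
move=> /andP[t0 tT] /andP[s0 sT]; have /andP[d1 d3] := hd.
set h := `|t - s|; set z := torus_dist x y; set H := h `^ _.
have zp : 0 <= z <= 2 * pi by rewrite torus_dist_ge0 torus_dist_le.
have Z0 := space_modulus_ge0 zp.
have h0 : 0 <= h by exact: normr_ge0.
have H0 : 0 <= H by exact: powR_ge0.
have c0 : 0 <= T `^ (d%:R / 4) by exact: powR_ge0.
pose B (m : nat) : R := if m is n.+1 then Num.min h (n.+1%:R ^+ 4)^-1 +
      2 * (Num.min 1 ((n.+1%:R * z) ^+ 2) / n.+1%:R ^+ 4) else h.
have B0 m : 0 <= B m.
  case: m => [//|n]; rewrite /B addr_ge0//.
    by rewrite le_min h0 invr_ge0 exprn_ge0.
  by rewrite mulr_ge0// divr_ge0 ?exprn_ge0// le_min ler01 sqr_ge0.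
apply: (le_trans (cube_sum_le_shells N d1 B0 _)).
  by move=> k j kj; exact: mode_dist_shell_le.
rewrite -mulrA ler_wpM2l//; apply: (le_trans (shell_sum_le N B0)).
(* The crossover frequency h^(-1/4) makes sense only for h > 0; for h = 0 the time part vanishes
   term by term. *)
have [hh|h1] := eqVneq h 0.
  have -> : \sum_(m < N) m.+1%:R ^+ d.-1 * B m.+1 =
    2 * \sum_(m < N) m.+1%:R ^+ d.-1 * (Num.min 1 ((m.+1%:R * z) ^+ 2) / m.+1%:R ^+ 4).
    rewrite mulr_sumr; apply: eq_bigr => m _; rewrite /B hh min_l ?invr_ge0 ?exprn_ge0//.
    by rewrite add0r mulrCA.
  have := space_shell_sum_le N zp; rewrite /B hh; nra.
have hp : 0 < h by rewrite lt_def h1.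
(* The null frequency contributes [h], and h^(d/4) <= T^(d/4). The 32 in the constant is 4 * 2 * 4:
   index shift, factor of 1 - c, and space sum. *)
have hH : h <= H * T `^ (d%:R / 4).
  have {1}-> : h = H * h `^ (d%:R / 4).
    rewrite /H -powRD ?(gt_eqF hp) ?implybT//.
    by rewrite subrK powRr1.
  rewrite ler_wpM2l// ge0_ler_powR ?nnegrE//.
  - exact: le_trans tT.
  - by rewrite /h ler_norml; apply/andP; split; lra.
have -> : \sum_(m < N) m.+1%:R ^+ d.-1 * B m.+1 =
    \sum_(m < N) m.+1%:R ^+ d.-1 * Num.min h (m.+1%:R ^+ 4)^-1 +
    2 * \sum_(m < N) m.+1%:R ^+ d.-1 * (Num.min 1 ((m.+1%:R * z) ^+ 2) / m.+1%:R ^+ 4).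
  rewrite mulr_sumr -big_split/=; apply: eq_bigr => m _.
  by rewrite mulrDr; congr (_ + _); rewrite mulrCA.
have := space_shell_sum_le N zp; have := time_shell_sum_le N hp.
rewrite -/H /B; nra.
Qed.

(** Gives the absolute convergence of the Green series: e^(-a) <= 1/a reduces it to m^(d - 1) / m^4
    <= m^(-2). *)
Lemma cube_sum_exp_lambda_le (tau : R) (N : nat) : 0 < tau ->
  cube_sum N (fun k : 'I_d -> nat => expR (- lambda k * tau)) <= d%:R * (1 + 16 / tau).
Proof.
move=> tau0; have /andP[d1 d3] := hd.
pose B (m : nat) : R := if m is n.+1 then (n.+1%:R ^+ 4)^-1 / tau else 1.
have B0 m : 0 <= B m by case: m => // n; rewrite divr_ge0 ?invr_ge0 ?exprn_ge0// ltW.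
apply: (le_trans (cube_sum_le_shells N d1 B0 _)).
  move=> k j kj; have lj := ler_lambda (R := R) k j; rewrite /B.
  have lt0 : 0 <= lambda k * tau by rewrite mulr_ge0 ?lambda_ge0 ?ltW.
  move: lj; case: (k j) => [_|n lj].
    by rewrite -[leRHS]expR0 ler_expR mulNr oppr_le0.
  have n4 : 0 < n.+1%:R ^+ 4 :> R by rewrite exprn_gt0.
  rewrite mulNr expRN -invfM lef_pV2 ?posrE ?expR_gt0 ?mulr_gt0//.
  apply: le_trans (_ : _ <= 1 + lambda k * tau) (expR_ge1Dx _).
  by rewrite -[leLHS]add0r lerD// ler_wpM2r// ltW.
rewrite ler_wpM2l//; apply: (le_trans (shell_sum_le N B0)).
rewrite /B lerD2l.
suff : \sum_(m < N) m.+1%:R ^+ d.-1 * ((m.+1%:R ^+ 4)^-1 / tau) <= 4 / tau :> R.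
  by have : 16 / tau = 4 * (4 / tau) by [rewrite mulrA -natrM]; move=> ->; rewrite ler_pM2l.
apply: (@le_trans _ _ (\sum_(m < N) Num.min 1 ((1 / m.+1%:R) ^+ 2) / tau)).
  apply: ler_sum => m _; set n : R := m.+1%:R.
  have n1 : 1 <= n by rewrite /n ler1n.
  have n0 : 0 < n by exact: lt_le_trans n1.
  rewrite mulrA ler_wpM2r ?invr_ge0 ?(ltW tau0)//.
  have -> : Num.min 1 ((1 / n) ^+ 2) = n ^+ 2 / n ^+ 4.
    rewrite mul1r exprVn min_r ?invf_le1 ?exprn_gt0 ?exprn_ege1//.
    by field; rewrite gt_eqF.
  rewrite ler_wpM2r ?invr_ge0 ?exprn_ge0 ?(ltW n0)// ler_weXn2l//.
  by move: d3; case: d => [|[|[|[|]]]].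
rewrite -mulr_suml ler_wpM2r ?invr_ge0 ?(ltW tau0)//.
by rewrite -[4]mulr1 sum_min_sqr_le.
Qed.

End lattice_upper_bound.

(** * Lower bounds for the lattice sums *)

Section lattice_lower_bound.
Context {R : realType}.
Variable d : nat.
Hypothesis hd : (1 <= d <= 3)%N.

(** With n the integer part of M = h^(-1/4), every frequency with entries at most n has lambda h <=
    d, hence a term of order [h]. There are (n + 1)^d >= M^d of them, and M^d h = h^(1 - d/4). *)
Lemma cube_sum_mode_dist_ge_time (t s : R) (x y : d.-tuple R) : 0 <= t -> 0 <= s ->
  exists N, ((2 * pi) ^+ d)^-1 / (1 + 2 * d%:R) * `|t - s| `^ (1 - d%:R / 4) <=
    cube_sum N (mode_dist t s x y).
Proof.
move=> t0 s0; set h := `|t - s|; have h0 : 0 <= h by exact: normr_ge0.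
have pid : 0 < (2 * pi) ^+ d :> R by rewrite exprn_gt0 ?mulr_gt0 ?pi_gt0.
have dd : 0 < 1 + 2 * d%:R :> R by rewrite ltr_pwDl.
have [->|h1] := eqVneq h 0.
  exists 0%N; rewrite powR0 ?mulr0.
    by apply: sumr_ge0 => k _; exact: mode_dist_ge0.
  by move: hd; case: d => [|[|[|[|]]]]// _; lra.
have hp : 0 < h by rewrite lt_def h1.
pose M := h `^ (- 4^-1); have M0 : 0 < M by exact: powR_gt0.
have M4 : M ^+ 4 = h^-1.
  by rewrite -powR_mulrn ?powR_ge0// -powRrM mulNr mulVf// powR_inv1// ltW.
have hM : h `^ (1 - d%:R / 4) = M ^+ d * h.
  rewrite -powR_mulrn ?powR_ge0// -powRrM -[X in _ = _ * X](powRr1 (ltW hp)).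
  by rewrite -powRD ?(gt_eqF hp) ?implybT//; congr (_ `^ _); field.
pose n := Num.truncn M.
have /andP[nM Mn] : n%:R <= M < n.+1%:R by apply: truncn_itv; exact: ltW.
exists n.+1; rewrite hM.
apply: (@le_trans _ _ (\sum_(k : {ffun 'I_d -> 'I_n.+1}) ((2 * pi) ^+ d)^-1 / (1 + 2 * d%:R) * h)).
  rewrite sumr_const card_ffun !card_ord -[leRHS]mulr_natl mulrCA.
  rewrite ler_wpM2r ?mulr_ge0 ?divr_ge0 ?invr_ge0 ?(ltW pid) ?(ltW dd)//.
  by rewrite natrX lerXn2r ?nnegrE// ltW.
apply: ler_sum => k _; rewrite /mode_dist -mulrA.
apply: ler_pM; rewrite ?invr_ge0 ?(ltW pid) ?mulr_ge0 ?invr_ge0 ?(ltW dd)//.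
  exact: mode_weight_ge.
apply: le_trans (mode_var_lambda_ge _ x y t0 s0); rewrite -/h.
set l := lambda _.
have l0 : 0 <= l by exact: lambda_ge0.
have lh : l * h <= d%:R.
  apply: (@le_trans _ _ (d%:R * n%:R ^+ 4 * h)).
    rewrite ler_wpM2r//; apply: lambda_le => i; by rewrite -ltnS.
  have : n%:R ^+ 4 <= h^-1 by rewrite -M4 lerXn2r ?nnegrE// ltW.
  move=> n4; apply: (@le_trans _ _ (d%:R * h^-1 * h)); last by rewrite mulfVK.
  by rewrite ler_wpM2r// ler_wpM2l.
rewrite mulrC ler_wpM2l// lef_pV2 ?posrE// -?mulrA ?ltr_pwDl ?mulr_ge0//.
by rewrite lerD2l ler_wpM2l.
Qed.

(** Either alternative keeps the other cosines from compensating factor [j]: it is nonnegative, or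
    it is the only factor left. The 16 is 8 from the cosine bound times 2 from 2 l. *)
Lemma mode_dist_ge_space (t s t0 : R) (x y : d.-tuple R) (k : 'I_d -> nat) (j : 'I_d) :
  0 < t0 -> t0 <= t -> t0 <= s -> (0 < k j)%N ->
  0 <= cos ((k j)%:R * torus_diff x y j) \/ (forall i, i != j -> k i = 0%N) ->
  (k j)%:R * `|torus_diff x y j| <= pi ->
  ((2 * pi) ^+ d)^-1 * (1 - expR (- (2 * t0))) *
    ((k j)%:R * `|torus_diff x y j|) ^+ 2 / (16 * lambda k) <=
  mode_dist t s x y k.
Proof.
move=> t00 tt0 st0 kj0 hc kd.
have l1 : 1 <= lambda k :> R.
  by apply: le_trans (ler_lambda k j); rewrite exprn_ege1// ler1n.
have l0 : 0 < lambda k :> R by exact: lt_le_trans l1.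
have pid : 0 < (2 * pi) ^+ d :> R by rewrite exprn_gt0 ?mulr_gt0 ?pi_gt0.
have e0 : 0 <= 1 - expR (- (2 * t0)).
  by rewrite subr_ge0 -expR0 ler_expR oppr_le0 mulr_ge0// ltW.
have cc := mode_cos_itv k x y.
have key : ((k j)%:R * `|torus_diff x y j|) ^+ 2 / 8 <= 1 - mode_cos k x y.
  have nE : `|(k j)%:R * torus_diff x y j| = (k j)%:R * `|torus_diff x y j|.
    by rewrite normrM ger0_norm.
  rewrite -nE real_normK ?num_real//.
  apply: (@le_trans _ _ (1 - cos ((k j)%:R * torus_diff x y j))).
    by apply: oneBcos_ge_sqr; rewrite nE.
  rewrite mode_cosE; case: hc => [c0|k0].
    by apply: (oneBprod_ge (f := fun i => cos ((k i)%:R * torus_diff x y i))) => // i; exact: cos_max.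
  rewrite (bigD1 j)//= big1 ?mulr1// => i ij.
  by rewrite k0// mul0r cos0.
rewrite /mode_dist.
apply: le_trans (_ : ((2 * pi) ^+ d)^-1 *
  ((1 - expR (- (2 * t0))) * (1 - mode_cos k x y) / (2 * lambda k)) <= _).
  rewrite [leLHS](_ : _ = ((2 * pi) ^+ d)^-1 * ((1 - expR (- (2 * t0))) *
    (((k j)%:R * `|torus_diff x y j|) ^+ 2 / 8) / (2 * lambda k))); last first.
    by field; rewrite !gt_eqF.
  rewrite ler_wpM2l ?invr_ge0 ?(ltW pid)// ler_wpM2r ?invr_ge0 ?mulr_ge0 ?(ltW l0)//.
  by rewrite ler_wpM2l.
apply: ler_pM.
- by rewrite invr_ge0 ltW.
- by rewrite divr_ge0 ?mulr_ge0// ?subr_ge0 ?(ltW l0)//; case/andP: cc.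
- exact: mode_weight_ge.
- by apply: mode_var_ge_space => //; exact: ltW.
Qed.

Definition space_const (t0 : R) : R :=
  ((2 * pi) ^+ d)^-1 * (1 - expR (- (2 * t0))) / (16 * d%:R).

Lemma space_const_gt0 t0 : 0 < t0 -> 0 < space_const t0.
Proof.
move=> t00; have /andP[d0 _] := hd.
rewrite divr_gt0 ?mulr_gt0 ?invr_gt0 ?exprn_gt0 ?mulr_gt0 ?pi_gt0 ?ltr0n//.
by rewrite subr_gt0 -expR0 ltr_expR oppr_lt0 mulr_gt0.
Qed.

(** [D] stands for the largest coordinate difference, K + 1 for a bound on pi / (2 D). For d = 2, 2
    pi e / D <= 4 e (K + 1) and the harmonic sum dominates ln (K + 1); for d = 3 the sum is K, so
    D^2 (1 + K) exceeds pi D / 2 while z <= 2 D. *)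
Lemma space_modulus_le (z D : R) (K : nat) : 0 < D -> D <= z -> z <= 2 * pi ->
  z ^+ 2 <= d%:R * D ^+ 2 -> pi / (2 * D) < K.+1%:R ->
  space_modulus d z <=
    8 * (D ^+ 2 * (1 + \sum_(m < K) m.+1%:R ^+ d.-1 / m.+1%:R ^+ 2)).
Proof.
move=> Dp Dz z2pi zD K2.
have pi2 := pi_ge2 R.
have zp : 0 < z by exact: lt_le_trans Dz.
have z0 := ltW zp; have D0 := ltW Dp.
move: zD; rewrite /space_modulus; case/andP: hd; case: d => [|[|[|[|]]]]//= _ _ zD;
  set S := \sum_(m < K) _.
- rewrite mul1r; have S0 : 0 <= S by apply: sumr_ge0 => m _; rewrite divr_ge0 ?exprn_ge0.
  by have := sqr_ge0 D; move: zD; rewrite (_ : minn 2 (4 - 1) = 2%N)//; nra.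
- have lnle : ln (log_const / z) <= 4 * (1 + S).
    have -> : S = \sum_(m < K) m.+1%:R^-1.
      by apply: eq_bigr => m _; rewrite expr1 expr2 invfM mulrA mulfV ?mul1r// pnatr_eq0.
    have hK := @ln_le_harmonic R K.
    have : ln (log_const / z) <= ln (expR 1 * 4 * K.+1%:R).
      rewrite ler_ln ?posrE ?divr_gt0 ?mulr_gt0 ?expR_gt0 ?pi_gt0 ?ltr0Sn//.
      apply: (@le_trans _ _ (log_const / D)).
        by apply: ler_wpM2l; [exact: (ltW (@log_const_gt0 R))|rewrite lef_pV2 ?posrE].
      rewrite /log_const -!mulrA ler_wpM2l ?expR_ge0//.
      rewrite mulrA ler_pdivrMr//.
      by move: K2; rewrite ltr_pdivrMr ?mulr_gt0//; nra.
    have -> : ln (expR 1 * 4 * K.+1%:R) = 1 + ln 4 + ln (K.+1%:R) :> R.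
      by rewrite lnM ?posrE ?mulr_gt0 ?expR_gt0 ?ltr0Sn// lnM ?posrE ?expR_gt0// expRK.
    have : ln (4 : R) <= 3.
      by rewrite (_ : 4 = 1 + 3 :> R); [apply: le_ln1Dx; lra|lra].
    have : 0 <= ln (K.+1%:R : R) by rewrite ln_ge0// ler1n.
    lra.
  have ln0 : 0 <= ln (log_const / z).
    by apply: le_trans (ln_log_const_ge1 _) => //; rewrite zp.
  rewrite expr1 (_ : minn 2 (4 - 2) = 2%N)//.
  apply: le_trans (ler_pM ln0 (sqr_ge0 _) lnle zD) _.
  by rewrite le_eqVlt; apply/orP; left; apply/eqP; ring.
- have -> : S = K%:R.
    rewrite /S (eq_bigr (fun=> 1)); last by move=> m _; rewrite divff// expf_neq0// pnatr_eq0.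
    by rewrite sumr_const card_ord.
  rewrite mul1r expr1 (_ : 1 + K%:R = K.+1%:R); last by rewrite addrC natr1.
  have z2 : z <= 2 * D.
    rewrite -ler_sqr ?nnegrE ?mulr_ge0//; apply: (le_trans zD).
    by rewrite exprMn; have := sqr_ge0 D; lra.
  move: K2; rewrite ltr_pdivrMr ?mulr_gt0// => K2.
  nra.
Qed.

Lemma cube_sum_mode_dist_ge_space (t s t0 : R) (x y : d.-tuple R) :
  0 < t0 -> t0 <= t -> t0 <= s ->
  exists N, space_const t0 / 16 * space_modulus d (torus_dist x y) <=
    cube_sum N (mode_dist t s x y).
Proof.
move=> t00 tt0 st0; have /andP[d0 d3] := hd.
have t_ge0 : 0 <= t by rewrite (le_trans (ltW t00)).
have s_ge0 : 0 <= s by rewrite (le_trans (ltW t00)).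
have F0 k : 0 <= mode_dist t s x y k by exact: mode_dist_ge0.
have c0 := space_const_gt0 t00.
set z := torus_dist x y.
have [j _ jmax] : exists2 j : 'I_d, true & forall i, `|torus_diff x y i| <= `|torus_diff x y j|.
  have [j _ H] := @Order.TotalTheory.arg_maxP _ _ _ (Ordinal d0) xpredT
    (fun i => `|torus_diff x y i|) erefl.
  by exists j => // i; exact: H.
set D := `|torus_diff x y j| in jmax.
have D0 : 0 <= D by exact: normr_ge0.
have Dpi : D <= pi by exact: centered_rep_norm.
have Dz : D <= z by exact: torus_diff_le.
have z0 : 0 <= z by exact: torus_dist_ge0.
have zD : z ^+ 2 <= d%:R * D ^+ 2.
  rewrite torus_distE; apply: (@le_trans _ _ (\sum_(i < d) D ^+ 2)).
    by apply: ler_sum => i _; rewrite -real_normK ?num_real// lerXn2r ?nnegrE.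
  by rewrite sumr_const card_ord mulr_natl.
have [Dzero|D1] := eqVneq D 0.
  exists 0%N; have -> : z = 0.
    by apply/eqP; rewrite -sqrf_eq0 eq_le sqr_ge0 andbT (le_trans zD)// Dzero expr0n mulr0.
  by rewrite space_modulus0// mulr0 sumr_ge0.
have Dp : 0 < D by rewrite lt_def D1.
(* Largest shell index for which k_j D <= pi/2, so that cosine [j] is nonnegative. It is 0 when D >
   pi/2. *)
pose K := Num.truncn (pi / (2 * D)).
have /andP[K1 K2] : K%:R <= pi / (2 * D) < K.+1%:R.
  by apply: truncn_itv; rewrite divr_ge0 ?pi_ge0 ?mulr_ge0.
pose S := \sum_(m < K) m.+1%:R ^+ d.-1 / m.+1%:R ^+ 2 : R.
(* The unit frequency at [j] supplies the 1 in 1 + S, and everything when K = 0; side K + 2 leaves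
   room for its entry 1. *)
have A : space_const t0 * D ^+ 2 <= cube_sum K.+2 (mode_dist t s x y).
  pose e : {ffun 'I_d -> 'I_K.+2} := [ffun i => inord (i == j)].
  have ej i : e i = (i == j) :> nat.
    by rewrite ffunE inordK//; case: (i == j).
  have eE : (fun i => e i : nat) = (fun i => (i == j) : nat) by apply/funext => i; rewrite ej.
  rewrite /cube_sum (bigD1 e)//= eE -[leLHS]addr0 lerD ?sumr_ge0//.
  have le : lambda (fun i : 'I_d => (i == j) : nat) = 1 :> R.
    rewrite /lambda (bigD1 j)//= eqxx expr1n big1 ?addr0// => i /negbTE ->.
    by rewrite expr0n.
  apply: le_trans (mode_dist_ge_space (j := j) t00 tt0 st0 _ _ _) => /=.
  - rewrite eqxx mul1r le mulr1 -/D /space_const.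
    rewrite mulrAC ler_wpM2l ?mulr_ge0 ?sqr_ge0 ?invr_ge0 ?exprn_ge0 ?mulr_ge0 ?pi_ge0//.
      by rewrite subr_ge0 -expR0 ler_expR oppr_le0 mulr_ge0// ltW.
    by rewrite lef_pV2 ?posrE ?mulr_gt0 ?ltr0n// ler_peMr// ler1n.
  - by rewrite eqxx.
  - by right => i /negbTE ->.
  - by rewrite eqxx mul1r.
have Bd : space_const t0 * D ^+ 2 * S <= cube_sum K.+2 (mode_dist t s x y).
  (* Cut off to the shells 1, ..., K: the first and last of the K + 2 terms vanish, which accounts
     for the reindexing below. *)
  pose B (m : nat) : R := if (0 < m <= K)%N then space_const t0 * D ^+ 2 / m%:R ^+ 2 else 0.
  apply: (@le_trans _ _ (\sum_(m < K.+2) (m.+1 ^ d.-1)%:R * B m)); last first.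
    apply: (@cube_sum_ge_shells _ _ _ _ _ j) => // k kj; rewrite /B.
    case: ifPn => // /andP[k0 kK].
    have kD : (k j)%:R * D <= pi / 2.
      apply: (@le_trans _ _ (K%:R * D)); first by rewrite ler_wpM2r// ler_nat.
      by move: K1; rewrite ler_pdivlMr ?mulr_gt0//; lra.
    have n4 : 0 < (k j)%:R ^+ 4 :> R by rewrite exprn_gt0// ltr0n.
    have l0 : 0 < lambda k :> R by exact: lt_le_trans (ler_lambda k j).
    apply: le_trans (mode_dist_ge_space (j := j) t00 tt0 st0 k0 _ _).
    + rewrite -/D /space_const.
      have -> : ((2 * pi) ^+ d)^-1 * (1 - expR (- (2 * t0))) / (16 * d%:R) *
          D ^+ 2 / (k j)%:R ^+ 2 =
        ((2 * pi) ^+ d)^-1 * (1 - expR (- (2 * t0))) * ((k j)%:R * D) ^+ 2 /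
          (16 * (d%:R * (k j)%:R ^+ 4)).
        field; rewrite !pnatr_eq0 -!lt0n d0 k0/=.
        by rewrite expf_neq0// mulf_neq0// gt_eqF// pi_gt0.
      rewrite ler_wpM2l ?mulr_ge0 ?sqr_ge0 ?invr_ge0 ?exprn_ge0 ?mulr_ge0 ?pi_ge0//.
        by rewrite subr_ge0 -expR0 ler_expR oppr_le0 mulr_ge0// ltW.
      by rewrite lef_pV2 ?posrE ?mulr_gt0 ?ltr0n// ler_pM2l//; exact: lambda_le.
    + left; apply: cos_ge0_pihalf; rewrite -ler_norml normrM ger0_norm//.
    + by apply: le_trans kD _; have := pi_ge0 R; lra.
  rewrite big_ord_recl big_ord_recr /= {1 3}/B /= ltnn !mulr0 add0r addr0.
  rewrite mulr_sumr; apply: ler_sum => m _.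
  rewrite /B /bump leq0n add1n /= ltn_ord.
  have m1 : 0 < m.+1%:R :> R by rewrite ltr0Sn.
  rewrite [leLHS](_ : _ = m.+1%:R ^+ d.-1 * (space_const t0 * D ^+ 2 / m.+1%:R ^+ 2)); last by ring.
  apply: ler_wpM2r.
    by apply: divr_ge0; [exact: mulr_ge0 (ltW c0) (sqr_ge0 D)|exact: sqr_ge0].
  by rewrite -natrX ler_nat; case: d.-1 => // e; rewrite leq_exp2r.
exists K.+2.
(* Adding [A] and [Bd] costs a factor 2 on top of this 8, whence the 16 in the statement. *)
suff : space_modulus d z <= 8 * (D ^+ 2 * (1 + S)).
  move=> H; have := ler_wpM2l (ltW c0) H; lra.
by apply: space_modulus_le => //; exact: torus_dist_le.
Qed.

End lattice_lower_bound.

(** * The Green kernel as an L2 limit of modes *)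

Section green_kernel.
Context {R : realType}.
Variable d : nat.
Hypothesis hd : (1 <= d <= 3)%N.
Implicit Types x y : d.-tuple R.

Definition green_kernel (t : R) x (z : R * d.-tuple R) : R :=
  if 0 <= z.1 <= t then green (t - z.1) x z.2 else 0.

Lemma cvg_cube_sum_mode (t : R) x (z : R * d.-tuple R) :
  cube_sum N (fun k => mode t x k z) @[N --> \oo] --> green_kernel t x z.
Proof.
rewrite /green_kernel; have [/andP[r0 rt]|rt] := boolP (0 <= z.1 < t); last first.
  have -> : (fun N => cube_sum N (fun k => mode t x k z)) = cst 0.
    apply/funext => N; rewrite /cube_sum big1// => k _.
    by rewrite /mode /time_factor indicE mem_setE in_itv/= (negbTE rt) !mul0r mulr0.
  case: ifPn => [/andP[r0 rt']|_]; last exact: cvg_cst.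
  (* Boundary case r = t: the kernel takes the conventional value of [green] at time 0. *)
  move: rt; rewrite r0/= -leNgt => tr.
  have -> : t - z.1 = 0 by apply/eqP; rewrite subr_eq0 eq_le tr rt'.
  by rewrite /green ltxx; exact: cvg_cst.
have tau0 : 0 < t - z.1 by rewrite subr_gt0.
rewrite r0 (ltW rt)/= /green tau0.
have -> : (fun N => cube_sum N (fun k => mode t x k z)) =
    (fun N => cube_sum N (green_term (t - z.1) x z.2)).
  apply/funext => N; apply: eq_bigr => k _.
  rewrite /mode /time_factor indicE mem_setE in_itv/= r0 rt mul1r.
  by rewrite /green_term /mode_weight mulrCA mulrA.
apply: (@is_cvg_cube_sum _ _ _ (fun k => expR (- lambda k * (t - z.1)))
  (d%:R * (1 + 16 / (t - z.1)))).
  move=> k; rewrite /green_term normrM -[leRHS]mulr1.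
  rewrite ler_pM// ?norm_cos_prod_le1// normrM ger0_norm ?expR_ge0//.
  rewrite -[leRHS]mulr1 ler_wpM2l ?expR_ge0//.
  have := mode_weight_le1 (R := R) k; rewrite /mode_weight => w1.
  by rewrite ger0_norm// (ltW (mode_weight_gt0 k)).
by move=> N; exact: cube_sum_exp_lambda_le.
Qed.

Lemma measurable_cube_sum_mode (t : R) x N :
  measurable_fun setT (fun z => cube_sum N (fun k => mode t x k z)).
Proof. by apply: measurable_sum => k; exact: measurable_mode. Qed.

Lemma measurable_green_kernel (t : R) x : measurable_fun setT (green_kernel t x).
Proof.
apply: (measurable_fun_cvg (measurable_cube_sum_mode t x)) => z _.
exact: cvg_cube_sum_mode.
Qed.

(** The cube sums increase and the upper estimate bounds them, so their limit exists. Orthogonality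
    over a difference of two cubes provides the Cauchy hypothesis of [integral_sqr_limit]. *)
Lemma integral_sqr_green_kernelB (T t s : R) x y : 0 <= t <= T -> 0 <= s <= T ->
  exists2 L, cube_sum N (mode_dist t s x y) @[N --> \oo] --> L &
  (\int[spacetime_measure T d]_z ((green_kernel t x z - green_kernel s y z) ^+ 2)%:E = L%:E)%E.
Proof.
move=> tT sT; have /andP[t0 _] := tT; have /andP[s0 _] := sT.
have cS : cvgn (fun N => cube_sum N (mode_dist t s x y)).
  apply: nondecreasing_is_cvgn.
    by move=> N M NM; apply: ler_cube_sum => // k; exact: mode_dist_ge0.
  eexists => _ [N _ <-]; exact: (cube_sum_mode_dist_le hd x y N tT sT).
exists (limn (fun N => cube_sum N (mode_dist t s x y))) => //.
pose Dn N z := cube_sum N (fun k => mode t x k z) - cube_sum N (fun k => mode s y k z).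
have DnE N z : Dn N z = cube_sum N (fun k => mode t x k z - mode s y k z).
  by rewrite /Dn /cube_sum sumrB.
have [] // := @integral_sqr_limit _ _ _ (spacetime_measure T d)
  (fun z => green_kernel t x z - green_kernel s y z) Dn _ _ _ _ cS.
- by move=> N; apply: measurable_funB; exact: measurable_cube_sum_mode.
- by move=> z; apply: cvgB; exact: cvg_cube_sum_mode.
- move=> N; under eq_integral do rewrite DnE.
  exact: (integral_sqr_sum_modes x y xpredT tT sT).
- move=> n m nm.
  have diffE (F : ('I_d -> nat) -> R) : cube_sum m F - cube_sum n F =
      \sum_(k : {ffun 'I_d -> 'I_m} | ~~ [forall j, (k j < n)%N]) F (fun j => k j : nat).
    rewrite (cube_sum_widen _ nm) /cube_sum.
    rewrite (bigID (fun k : {ffun 'I_d -> 'I_m} => [forall j, (k j < n)%N]))/=.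
    by rewrite addrC addrK.
  under eq_integral do rewrite !DnE diffE.
  by rewrite diffE; exact: integral_sqr_sum_modes.
Qed.

Lemma L2_dist_sqr_biharmonic (T : R) (d' : measure_display)
    (Omega : measurableType d') (P : probability Omega R)
    (W : set (R * d.-tuple R) -> {RV P >-> R}) (u : R -> d.-tuple R -> {RV P >-> R})
    (t s : R) x y :
  is_white_noise (spacetime_measure T d) W -> is_biharmonic_process T W u ->
  0 <= t <= T -> 0 <= s <= T -> torus x -> torus y ->
  exists2 L, cube_sum N (mode_dist t s x y) @[N --> \oo] --> L &
  L2_dist_sqr (u t x) (u s y) = L%:E.
Proof.
move=> WN BH tT sT tx ty.
have [L SL LE] := integral_sqr_green_kernelB x y tT sT.
exists L => //; rewrite -LE.
exact: (wiener_isometry (spacetime_measure_lty d T) WN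
  (measurable_green_kernel t x) (measurable_green_kernel s y) (BH _ _ tT tx) (BH _ _ sT ty)).
Qed.

Lemma log_ge1_log_const : log_ge1 d (@log_const R).
Proof.
move=> x y _ _ z0; apply: ln_log_const_ge1.
rewrite lt_def z0 torus_dist_ge0 torus_dist_le//.
by case/andP: hd.
Qed.

Lemma torus_box_torus (c0 : 'I_d -> R) x : (forall j, 0 < c0 j < 2 * pi) ->
  torus_box c0 x -> torus x.
Proof.
move=> c00 xc j; have := xc j; have /andP[c1 c2] := c00 j => /andP[x1 x2].
by apply/andP; split; lra.
Qed.

End green_kernel.

Theorem theorem3p1 (R : realType) (d : nat) (hd : (1 <= d <= 3)%N) :
  (exists C : R, 0 < C /\ log_ge1 d C /\
    forall T : R, 0 < T ->
    exists c5 : R, 0 < c5 /\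
    forall (d' : measure_display) (Omega : measurableType d')
      (P : probability Omega R)
      (W : set (R * d.-tuple R) -> {RV P >-> R})
      (u : R -> d.-tuple R -> {RV P >-> R}),
    is_white_noise (spacetime_measure T d) W ->
    is_biharmonic_process T W u ->
    forall (t s : R) (x y : d.-tuple R),
      0 <= t <= T -> 0 <= s <= T -> torus x -> torus y ->
      (L2_dist_sqr (u t x) (u s y) <=
         (c5 * modulus d C `|t - s| (torus_dist x y))%:E)%E)
  /\
  (exists c : R, 0 < c /\ log_ge1 d c /\
    forall T t0 : R, 0 < t0 <= T ->
    exists c6 : R, 0 < c6 /\
    forall (d' : measure_display) (Omega : measurableType d')
      (P : probability Omega R)
      (W : set (R * d.-tuple R) -> {RV P >-> R})
      (u : R -> d.-tuple R -> {RV P >-> R}),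
    is_white_noise (spacetime_measure T d) W ->
    is_biharmonic_process T W u ->
    forall c0 : 'I_d -> R, (forall j, 0 < c0 j < 2 * pi) ->
    forall (t s : R) (x y : d.-tuple R),
      t0 <= t <= T -> t0 <= s <= T -> torus_box c0 x -> torus_box c0 y ->
      ((c6 * modulus d c `|t - s| (torus_dist x y))%:E <=
         L2_dist_sqr (u t x) (u s y))%E).
Proof.
have C0 := @log_const_gt0 R.
split; exists log_const; do 2!(split; first by [|exact: log_ge1_log_const]).
  move=> T T0; exists (d%:R * (T `^ (d%:R / 4) + 32)); split.
    by rewrite mulr_gt0 ?ltr0n//; [case/andP: hd|rewrite ltr_wpDl ?powR_ge0].
  move=> d' Omega P W u WN BH t s x y tT sT tx ty.
  have [L SL ->] := L2_dist_sqr_biharmonic hd WN BH tT sT tx ty.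
  rewrite lee_fin -(cvg_lim _ SL)//; apply: limr_le; first by apply/cvg_ex; exists L.
  by apply: nearW => N; exact: cube_sum_mode_dist_le.
move=> T t0 /andP[t00 t0T].
pose a : R := ((2 * pi) ^+ d)^-1 / (1 + 2 * d%:R).
pose b : R := space_const d t0 / 16.
have a0 : 0 < a.
  by rewrite divr_gt0 ?invr_gt0 ?exprn_gt0 ?mulr_gt0 ?pi_gt0// ltr_pwDl.
have b0 : 0 < b by rewrite divr_gt0// space_const_gt0.
(* The time and space lower bounds hold separately with constants [a] and [b]; their average bounds
   the sum of the two terms. *)
exists (Num.min a b / 2); split; first by rewrite divr_gt0// lt_min a0.
move=> d' Omega P W u WN BH c0 c00 t s x y /andP[tt0 tT] /andP[st0 sT] xJ yJ.
have t_ge0 : 0 <= t by rewrite (le_trans (ltW t00)).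
have s_ge0 : 0 <= s by rewrite (le_trans (ltW t00)).
have [L SL ->] := L2_dist_sqr_biharmonic hd WN BH (introT andP (conj t_ge0 tT))
  (introT andP (conj s_ge0 sT)) (torus_box_torus c00 xJ) (torus_box_torus c00 yJ).
rewrite lee_fin.
(* The two lower bounds hold on cubes of different sizes; monotonicity in N carries both to the
   limit [L]. *)
have SleL N : cube_sum N (mode_dist t s x y) <= L.
  rewrite -(cvg_lim _ SL)//; apply: nondecreasing_cvgn_le.
    by move=> n m nm; apply: ler_cube_sum => // k; exact: mode_dist_ge0.
  by apply/cvg_ex; exists L.
have [N1 /le_trans/(_ (SleL _)) H1] := cube_sum_mode_dist_ge_time hd x y t_ge0 s_ge0.
have [N2 /le_trans/(_ (SleL _)) H2] := cube_sum_mode_dist_ge_space hd x y t00 tt0 st0.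
have z2pi : 0 <= torus_dist x y <= 2 * pi.
  by rewrite torus_dist_ge0 torus_dist_le//; case/andP: hd.
have Z0 := space_modulus_ge0 hd z2pi.
have P0 : 0 <= `|t - s| `^ (1 - d%:R / 4) by exact: powR_ge0.
rewrite -/a in H1; rewrite -/b in H2.
have -> : modulus d log_const `|t - s| (torus_dist x y) =
  `|t - s| `^ (1 - d%:R / 4) + space_modulus d (torus_dist x y) by [].
have ma : Num.min a b <= a by rewrite ge_min lexx.
have mb : Num.min a b <= b by rewrite ge_min lexx orbT.
have h1 := ler_wpM2r P0 ma; have h2 := ler_wpM2r Z0 mb.
lra.
Qed.
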